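(* Let $(X,A)$ be a pair of cubical complexes (i.e. $X$ is a cubical complex and $A$ a subcomplex), $Y$ a diffeological space, and $f\colon X\to Y$ a tame map. Suppose there is a tame homotopy $h\colon A\times I\to Y$ satisfying $h_0=f|A$. Then there exists a tame homotopy $H\colon X\times I\to Y$ satisfying $H_0=f$ and $H|A\times I=h$.
   Context: All spaces are diffeological spaces and maps are smooth maps; $I=[0,1]$, $I^n$ and their subsets have the subspace diffeology from $\mathbf{R}^n$, and products the product diffeology. For a homotopy $h$, $h_t=h(\cdot,t)$. Let $K$ be a cubical subcomplex of $I^n$ (a union of faces), and $0<\epsilon\le1/2$. A smooth map $f\colon K\to Y$ is $\epsilon$-tame if $f(t_1,\dots,t_j,\dots,t_n)=f(t_1,\dots,t_{j-1},\alpha,t_{j+1},\dots,t_n)$ for all $(t_1,\dots,t_n)\in K$, all $j$ and all $\alpha\in\{0,1\}$ with $|t_j-\alpha|\le\epsilon$. It is tame if it is $\epsilon$-tame for some $\epsilon>0$. A cubical complex is a disjoint union of diffeological spaces, each diffeomorphic to a cubical subcomplex of $I^n$ for various $n\ge0$; thus it is a union of cubes $X_\lambda\cong I^{n(\lambda)}$, where faces of cubes are cubes of $X$, the intersection of two cubes is a face of each, and each connected component is a union of finitely many cubes. A subcomplex is a union of cubes of the complex. A smooth map $f\colon X\to Y$ from a cubical complex is tame if its restriction $f|X_\lambda$ to each cube is tame. A homotopy $h\colon X\times I\to Y$ between tame maps is tame if its restriction to $X_\lambda\times I\cong I^{n(\lambda)+1}$ is tame for each cube $X_\lambda$. *)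

(* Defs.v *)
From mathcomp Require Import all_boot all_order all_algebra.
From mathcomp Require Import all_classical all_reals all_analysis.

Set Implicit Arguments.
Unset Strict Implicit.
Unset Printing Implicit Defensive.

Import Order.TTheory GRing.Theory Num.Theory.
Import numFieldNormedType.Exports.

Local Open Scope classical_set_scope.
Local Open Scope ring_scope.

(* k-times (Frechet) differentiability on an open set U: f is differentiable and
   its partial derivatives are (k-1)-times differentiable.  Holding for all k,
   this is C^infinity on U.  Only the values of f on U matter, by
   [ntimes_diff_ext]. *)
Fixpoint ntimes_diff (R : realType) (m k : nat) (U : set 'rV[R]_m)
    (f : 'rV[R]_m -> R) : Prop :=
  if k is k'.+1 then
    (forall x, U x -> differentiable f x) /\
    (forall i : 'I_m, ntimes_diff k' U (fun x => 'D_(delta_mx 0 i) f x))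
  else True.

Definition smooth_fun (R : realType) (m : nat) (U : set 'rV[R]_m)
    (f : 'rV[R]_m -> R) : Prop :=
  forall k, ntimes_diff k U f.

Definition smooth_map (R : realType) (m n : nat) (U : set 'rV[R]_m)
    (g : 'rV[R]_m -> 'rV[R]_n) : Prop :=
  forall j : 'I_n, smooth_fun U (fun x => g x 0 j).

Section SmoothTheory.
Context {R : realType}.

Lemma near_eq_differentiable (V W : normedModType R) (f g : V -> W) (x : V) :
  {near x, f =1 g} -> differentiable f x -> differentiable g x.
Proof.
move=> fg df.
pose d := g - f.
have d0 : {near x, d =1 cst 0}.
  by move: fg; apply: filterS => y /= e; apply/eqP; rewrite subr_eq0 e.
have H : d \o shift x = cst (d x) + (cst 0 : V -> W) +o_ (0 : V) id.
  apply/eqaddoP => _/posnumP[e].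
  have dx : d x = 0 by have := nbhs_singleton d0.
  rewrite dx.
  have : \forall y \near (0 : V), d (y + x) = 0.
    have := d0; rewrite (near_shift 0 x) /=.
    apply: filterS => y /=; by rewrite subr0.
  apply: filterS => y /= dy.
  by rewrite !fctE /= dy !addr0 subr0 normr0 mulr_ge0.
have dd : 'd d x = (cst 0 : V -> W) :> (V -> W).
  have := @diff_unique _ V W d (\0 : {linear V -> W}) x.
  move=> -> //; exact: cst_continuous.
have -> : g = f + d by rewrite /d addrC subrK.
apply: differentiableD => //.
by apply/diff_locallyP; rewrite dd; split => //; exact: cst_continuous.
Qed.

Section Dim.
Context {m : nat}.
Implicit Types (U V : set 'rV[R]_m) (f g : 'rV[R]_m -> R) (k : nat).

Lemma open_near_eq U (T : Type) (f g : 'rV[R]_m -> T) x : open U ->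
  (forall y, U y -> f y = g y) -> U x -> {near x, f =1 g}.
Proof.
move=> oU fg Ux; have : nbhs x U by exact: open_nbhs_nbhs.
by apply: filterS => y Uy; exact: fg.
Qed.

Lemma ntimes_diff_ext k U f g : open U -> (forall x, U x -> f x = g x) ->
  ntimes_diff k U f -> ntimes_diff k U g.
Proof.
elim: k f g => //= k IH f g oU fg [df Df]; split=> [x Ux|i].
  by apply: near_eq_differentiable (df x Ux); exact: (open_near_eq oU).
apply: IH (Df i) => // x Ux.
by apply: near_eq_derive; exact: (open_near_eq oU).
Qed.

Lemma ntimes_diff_sub k U V f : V `<=` U -> ntimes_diff k U f ->
  ntimes_diff k V f.
Proof.
elim: k f => //= k IH f VU [df Df]; split=> [x /VU|i]; first exact: df.
exact: IH (Df i).
Qed.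

Lemma ntimes_diff_local k U f :
  (forall x, U x -> exists V, V x /\ ntimes_diff k V f) -> ntimes_diff k U f.
Proof.
elim: k f => //= k IH f loc; split=> [x Ux|i].
  by have [V [Vx [df _]]] := loc x Ux; exact: df.
by apply: IH => x Ux; have [V [Vx [_ /(_ i)]]] := loc x Ux; exists V.
Qed.

Lemma ntimes_diffS k U f : ntimes_diff k.+1 U f -> ntimes_diff k U f.
Proof.
elim: k f => // k IH f [df Df]; split=> // i.
exact: IH (Df i).
Qed.

Lemma ntimes_diff_cst k U (c : R) : open U -> ntimes_diff k U (fun=> c).
Proof.
elim: k c => //= k IH c oU; split=> [x _|i]; first exact: differentiable_cst.
apply: ntimes_diff_ext (IH 0 oU) => // x _.
by rewrite derive_cst.
Qed.

Lemma ntimes_diffD k U f g : open U -> ntimes_diff k U f ->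
  ntimes_diff k U g -> ntimes_diff k U (fun x => f x + g x).
Proof.
elim: k f g => //= k IH f g oU [df Df] [dg Dg]; split=> [x Ux|i].
  by apply: differentiableD; [exact: df|exact: dg].
apply: ntimes_diff_ext (IH _ _ oU (Df i) (Dg i)) => // x Ux.
by rewrite -[RHS]/('D_(delta_mx 0 i) (f + g) x) deriveD //;
  apply: diff_derivable; [exact: df|exact: dg].
Qed.

Lemma ntimes_diffM k U f g : open U -> ntimes_diff k U f ->
  ntimes_diff k U g -> ntimes_diff k U (fun x => f x * g x).
Proof.
elim: k f g => //= k IH f g oU hf hg.
have [df Df] := hf; have [dg Dg] := hg; split=> [x Ux|i].
  by apply: differentiableM; [exact: df|exact: dg].
have := ntimes_diffD oU (IH _ _ oU (@ntimes_diffS _ _ _ hf) (Dg i))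
                        (IH _ _ oU (@ntimes_diffS _ _ _ hg) (Df i)).
apply: ntimes_diff_ext => // x Ux.
by rewrite -[RHS]/('D_(delta_mx 0 i) (f * g) x) deriveM //;
  apply: diff_derivable; [exact: df|exact: dg].
Qed.

Lemma ntimes_diff_sum k U n (F : 'I_n -> 'rV[R]_m -> R) : open U ->
  (forall j, ntimes_diff k U (F j)) ->
  ntimes_diff k U (fun x => \sum_(j < n) F j x).
Proof.
move=> oU; elim: n F => [|n IH] F hF.
  apply: ntimes_diff_ext (ntimes_diff_cst k 0 oU) => // x _.
  by rewrite big_ord0.
have := ntimes_diffD oU (IH (fun j => F (widen_ord (leqnSn n) j))
   (fun j => hF _)) (hF ord_max).
by apply: ntimes_diff_ext => // x _; rewrite big_ord_recr.
Qed.

End Dim.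

Lemma differentiable_row (m n : nat) (g : 'rV[R]_m -> 'rV[R]_n) x :
  (forall j, differentiable (fun y => g y 0 j) x) -> differentiable g x.
Proof.
move=> dg.
have -> : g = \sum_(j < n) (fun y => g y 0 j *: (delta_mx 0 j : 'rV[R]_n)).
  by apply/funext => y; rewrite fct_sumE {1}[g y]row_sum_delta.
by apply: differentiable_sum => j; exact: differentiableZl.
Qed.

Lemma derive_comp_row (m n : nat) (f : 'rV[R]_n -> R)
    (g : 'rV[R]_m -> 'rV[R]_n) x v :
  differentiable g x -> differentiable f (g x) ->
  'D_v (f \o g) x =
  \sum_(j < n) 'D_v (fun y => g y 0 j) x * 'D_(delta_mx 0 j) f (g x).
Proof.
move=> dg df.
rewrite deriveE; last exact: differentiable_comp.
rewrite diff_comp //= {1}['d g x v]row_sum_delta linear_sum.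
apply: eq_bigr => j _; rewrite linearZ /= (deriveE _ df); congr (_ * _).
by rewrite -(deriveE _ dg) derive_mx ?mxE //; exact: diff_derivable.
Qed.

Lemma ntimes_diff_comp (m n k : nat) (U : set 'rV[R]_n) (V : set 'rV[R]_m)
    (f : 'rV[R]_n -> R) (g : 'rV[R]_m -> 'rV[R]_n) :
  open V -> (forall v, V v -> U (g v)) ->
  (forall j, ntimes_diff k V (fun x => g x 0 j)) ->
  ntimes_diff k U f -> ntimes_diff k V (f \o g).
Proof.
elim: k f => // k IH f oV VU hg [df Df].
have dg x : V x -> differentiable g x.
  by move=> Vx; apply: differentiable_row => j; have [d _] := hg j; exact: d.
split=> [x Vx|i].
  by apply: differentiable_comp; [exact: dg|exact/df/VU].
have hg' j := @ntimes_diffS _ _ _ _ (hg j).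
apply: (@ntimes_diff_ext _ _ _ (fun x => \sum_(j < n)
    'D_(delta_mx 0 i) (fun y => g y 0 j) x *
    ((fun z => 'D_(delta_mx 0 j) f z) \o g) x)) => //.
  by move=> x Vx; rewrite derive_comp_row //; [exact: dg|exact/df/VU].
apply: ntimes_diff_sum => // j; apply: ntimes_diffM => //.
  by have [_ D] := hg j; exact: D.
exact: IH oV VU hg' (Df j).
Qed.

End SmoothTheory.

(* [plot n U p] says that the restriction of [p] to the open set U of R^n is a
   plot: maps U -> X are represented by total functions, and [plot_ext] makes
   the values outside U irrelevant.  (When X is empty the only map into X, on
   the empty domain, has no total representative; it carries no information.) *)
Record diffeology (R : realType) (X : Type) := Diffeology {
  plot : forall n : nat, set 'rV[R]_n -> ('rV[R]_n -> X) -> Prop;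
  plot_open : forall n (U : set 'rV[R]_n) p, plot U p -> open U;
  plot_ext : forall n (U : set 'rV[R]_n) p q,
    (forall u, U u -> p u = q u) -> plot U p -> plot U q;
  plot_cst : forall n (U : set 'rV[R]_n) x, open U -> plot U (fun=> x);
  plot_local : forall n (U : set 'rV[R]_n) p,
    (forall u, U u -> exists V, [/\ V u, V `<=` U & plot V p]) -> plot U p;
  plot_comp : forall m n (U : set 'rV[R]_n) (V : set 'rV[R]_m) p g,
    plot U p -> open V -> smooth_map V g -> (forall v, V v -> U (g v)) ->
    plot V (p \o g)
}.

Record diffSpace (R : realType) := DiffSpace {
  diff_carrier :> Type;
  diff_struct : diffeology R diff_carrier
}.

Definition is_plot (R : realType) (X : diffSpace R) (n : nat)
    (U : set 'rV[R]_n) (p : 'rV[R]_n -> X) : Prop :=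
  plot (diff_struct X) U p.

Definition smooth (R : realType) (X Y : diffSpace R) (f : X -> Y) : Prop :=
  forall n (U : set 'rV[R]_n) (p : 'rV[R]_n -> X),
    is_plot U p -> is_plot U (f \o p).

Definition diffeomorphism (R : realType) (X Y : diffSpace R) (f : X -> Y) :
    Prop :=
  exists g : Y -> X, [/\ cancel f g, cancel g f, smooth f & smooth g].

Lemma open_local (R : realType) (n : nat) (U : set 'rV[R]_n) :
  (forall u, U u -> exists V, [/\ V u, V `<=` U & open V]) -> open U.
Proof.
move=> loc; rewrite openE => u /loc [V [Vu VU oV]].
by apply: filterS VU _; exact: open_nbhs_nbhs.
Qed.

Local Obligation Tactic := idtac.

Section Euclidean.
Variables (R : realType) (n : nat).

Definition euclid_plot m (U : set 'rV[R]_m) (p : 'rV[R]_m -> 'rV[R]_n) : Prop :=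
  open U /\ smooth_map U p.

Program Definition euclid_diffeology : diffeology R 'rV[R]_n :=
  @Diffeology R 'rV[R]_n euclid_plot _ _ _ _ _.
Next Obligation.
by move=> k U p [].
Qed.
Next Obligation.
move=> k U p q pq [oU sp]; split=> // j l.
by apply: ntimes_diff_ext (sp j l) => // u /pq ->.
Qed.
Next Obligation.
by move=> k U x oU; split=> // j l; exact: ntimes_diff_cst.
Qed.
Next Obligation.
move=> k U p loc; split=> [|j l].
  by apply: open_local => u /loc [V [Vu VU [oV _]]]; exists V.
by apply: ntimes_diff_local => u /loc [V [Vu _ [_ sp]]]; exists V; split=> //;
  exact: sp.
Qed.
Next Obligation.
move=> k l U V p g [oU sp] oV sg VU; split=> // j i.
exact: (ntimes_diff_comp (f := fun x => p x 0 j) oV VU (fun a => sg a i) (sp j i)).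
Qed.

Definition euclid : diffSpace R := DiffSpace euclid_diffeology.

End Euclidean.

Section RealLine.
Variable R : realType.

Definition real_plot m (U : set 'rV[R]_m) (p : 'rV[R]_m -> R) : Prop :=
  open U /\ smooth_fun U p.

Program Definition real_diffeology : diffeology R R :=
  @Diffeology R R real_plot _ _ _ _ _.
Next Obligation.
by move=> k U p [].
Qed.
Next Obligation.
move=> k U p q pq [oU sp]; split=> // l.
exact: ntimes_diff_ext (sp l).
Qed.
Next Obligation.
by move=> k U x oU; split=> // l; exact: ntimes_diff_cst.
Qed.
Next Obligation.
move=> k U p loc; split=> [|l].
  by apply: open_local => u /loc [V [Vu VU [oV _]]]; exists V.
by apply: ntimes_diff_local => u /loc [V [Vu _ [_ sp]]]; exists V; split=> //;
  exact: sp.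
Qed.
Next Obligation.
move=> k l U V p g [oU sp] oV sg VU; split=> // i.
exact: (ntimes_diff_comp oV VU (fun a => sg a i) (sp i)).
Qed.

Definition real_line : diffSpace R := DiffSpace real_diffeology.

End RealLine.

Section Subspace.
Variables (R : realType) (X : diffSpace R) (A : set X).

Definition sub_plot m (U : set 'rV[R]_m) (p : 'rV[R]_m -> A) : Prop :=
  is_plot U (fun u => val (p u)).

Program Definition sub_diffeology : diffeology R A :=
  @Diffeology R A sub_plot _ _ _ _ _.
Next Obligation.
by move=> k U p /plot_open.
Qed.
Next Obligation.
by move=> k U p q pq; apply: plot_ext => u /pq ->.
Qed.
Next Obligation.
by move=> k U x oU; exact: plot_cst.
Qed.
Next Obligation.
by move=> k U p loc; exact: plot_local.
Qed.
Next Obligation.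
by move=> k l U V p g pp oV sg VU; exact: (plot_comp pp).
Qed.

Definition sub_space : diffSpace R := DiffSpace sub_diffeology.

End Subspace.

Section Product.
Variables (R : realType) (X Y : diffSpace R).

Definition prod_plot m (U : set 'rV[R]_m) (p : 'rV[R]_m -> X * Y) : Prop :=
  is_plot U (fun u => (p u).1) /\ is_plot U (fun u => (p u).2).

Program Definition prod_diffeology : diffeology R (X * Y) :=
  @Diffeology R (X * Y) prod_plot _ _ _ _ _.
Next Obligation.
by move=> k U p [/plot_open].
Qed.
Next Obligation.
by move=> k U p q pq [p1 p2]; split;
  [apply: plot_ext p1 => u /pq ->|apply: plot_ext p2 => u /pq ->].
Qed.
Next Obligation.
by move=> k U x oU; split; exact: plot_cst.
Qed.
Next Obligation.
move=> k U p loc; split; apply: plot_local => u /loc [V [Vu VU [p1 p2]]];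
  by exists V.
Qed.
Next Obligation.
move=> k l U V p g [p1 p2] oV sg VU.
by split; [exact: (plot_comp p1)|exact: (plot_comp p2)].
Qed.

Definition prod_space : diffSpace R := DiffSpace prod_diffeology.

End Product.

Section DisjointUnion.
Variables (R : realType) (J : Type) (X : J -> diffSpace R).

Definition sum_plot m (U : set 'rV[R]_m) (p : 'rV[R]_m -> {j : J & X j}) :
    Prop :=
  open U /\
  forall u, U u -> exists (V : set 'rV[R]_m) (j : J) (q : 'rV[R]_m -> X j),
    [/\ V u, V `<=` U, is_plot V q & forall v, V v -> p v = existT _ j (q v)].

Program Definition sum_diffeology : diffeology R {j : J & X j} :=
  @Diffeology R {j : J & X j} sum_plot _ _ _ _ _.
Next Obligation.
by move=> k U p [].
Qed.
Next Obligation.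
move=> k U p q pq [oU loc]; split=> // u Uu.
have [V [j [r [Vu VU rV pr]]]] := loc u Uu.
by exists V, j, r; split=> // v Vv; rewrite -pq; [exact: pr|exact: VU].
Qed.
Next Obligation.
move=> k U x oU; split=> // u Uu; exists U, (projT1 x), (fun=> projT2 x).
by split=> //; [exact: plot_cst|case: x].
Qed.
Next Obligation.
move=> k U p loc.
split; first by apply: open_local => u /loc [V [Vu VU [oV _]]]; exists V.
move=> u /loc [V [Vu VU [_ /(_ u Vu) [W [j [q [Wu WV qW pq]]]]]]].
by exists W, j, q; split=> // w /WV /VU.
Qed.
Next Obligation.
move=> k l U V p g [oU loc] oV sg VU; split=> // v Vv.
have [W [j [q [Wg WU qW pq]]]] := loc _ (VU v Vv).
have oW := plot_open qW.
pose V' := V `&` g @^-1` W.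
have oV' : open V'.
  rewrite openE => w [Vw Ww].
  have gw : {for w, continuous g}.
    apply: differentiable_continuous; apply: differentiable_row => i.
    by have [d _] := sg i 1%N; exact: d.
  apply: filterI; first exact: open_nbhs_nbhs.
  by apply: gw; exact: open_nbhs_nbhs.
exists V', j, (q \o g); split=> //; first by move=> w [].
  apply: (plot_comp qW) => //; last by move=> w [].
  by move=> i n; apply: ntimes_diff_sub (sg i n) => w [].
by move=> w [_ Ww]; exact: pq.
Qed.

Definition sum_space : diffSpace R := DiffSpace sum_diffeology.

End DisjointUnion.

Definition unit_interval (R : realType) : set (real_line R) :=
  [set t : R | 0 <= t <= 1].

Definition I_space (R : realType) : diffSpace R :=
  sub_space (@unit_interval R).

Definition cube (R : realType) (n : nat) : set (euclid R n) :=
  [set t : 'rV[R]_n | forall i, 0 <= t 0 i <= 1].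

Definition cube_space (R : realType) (n : nat) : diffSpace R :=
  sub_space (@cube R n).

(* A d-dimensional face of I^n together with one of its coordinate
   identifications with I^d: each coordinate of R^n is either a constant 0
   ([false]) or 1 ([true]), or a coordinate of I^d, each of which is used
   exactly once. *)
Record face (n d : nat) := Face {
  face_coord : 'I_n -> 'I_d + bool;
  face_coordP : forall k : 'I_d, exists! i, face_coord i = inl k
}.

Definition face_map (R : realType) (n d : nat) (F : face n d)
    (s : 'rV[R]_d) : 'rV[R]_n :=
  \row_i match face_coord F i with inl k => s 0 k | inr a => a%:R end.

Definition face_set (R : realType) (n d : nat) (F : face n d) :
    set 'rV[R]_n :=
  face_map F @` @cube R d.

Definition cubical_subcomplex (R : realType) (n : nat) (K : set 'rV[R]_n) :
    Prop :=
  exists S : forall d, set (face n d),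
    K = [set t | exists d (F : face n d), S d F /\ face_set F t].

Definition set_coord (R : realType) (n : nat) (t : 'rV[R]_n) (j : 'I_n)
    (a : bool) : 'rV[R]_n :=
  \row_i (if i == j then a%:R else t 0 i).

(* [t'] ranges over the points of K equal to [set_coord (val t) j a]; when K is
   a cubical subcomplex and |t_j - a| <= e <= 1/2 there is exactly one. *)
Definition eps_tame (R : realType) (n : nat) (K : set (euclid R n))
    (Y : diffSpace R) (e : R) (f : sub_space K -> Y) : Prop :=
  smooth f /\
  forall (t t' : sub_space K) (j : 'I_n) (a : bool),
    `|(val t : 'rV[R]_n) 0 j - a%:R| <= e ->
    val t' = set_coord (val t) j a -> f t = f t'.

Definition tame_on_subcomplex (R : realType) (n : nat) (K : set (euclid R n))
    (Y : diffSpace R) (f : sub_space K -> Y) : Prop :=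
  exists e : R, 0 < e <= 2^-1 /\ eps_tame e f.

(* A diffeological space with a distinguished family of parametrized cubes
   I^d -> X, one parametrization for each identification of the cube
   with I^d. *)
Record cubedSpace (R : realType) := CubedSpace {
  cubed_carrier :> diffSpace R;
  cubes : forall d, set (cube_space R d -> cubed_carrier)
}.

Record cubicalComplex (R : realType) := CubicalComplex {
  cc_index : Type;
  cc_part : cc_index -> diffSpace R;
  cc_dim : cc_index -> nat;
  cc_model : forall j, set (euclid R (cc_dim j));
  cc_modelP : forall j, cubical_subcomplex (@cc_model j);
  cc_chart : forall j, cc_part j -> sub_space (@cc_model j);
  cc_chartP : forall j, diffeomorphism (@cc_chart j)
}.

Definition cc_space (R : realType) (X : cubicalComplex R) : diffSpace R :=
  sum_space (@cc_part R X).

(* The cubes of X are the faces of the I^n contained in the models. *)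
Definition cc_cubes (R : realType) (X : cubicalComplex R) (d : nat) :
    set (cube_space R d -> cc_space X) :=
  [set c | exists (j : cc_index X) (F : face (cc_dim j) d),
     forall s : cube_space R d, exists x : cc_part j,
       c s = existT _ j x /\ val (cc_chart x) = face_map F (val s)].

Coercion cc_cubed (R : realType) (X : cubicalComplex R) : cubedSpace R :=
  CubedSpace (@cc_cubes R X).

Definition is_subcomplex (R : realType) (X : cubedSpace R) (A : set X) : Prop :=
  exists S : forall d, set (cube_space R d -> X),
    (forall d, S d `<=` @cubes R X d) /\
    A = [set x | exists d c s, S d c /\ c s = x].

(* The subcomplex A with the subspace diffeology; its cubes are the cubes of X
   lying in A. *)
Definition sub_cubed (R : realType) (X : cubedSpace R) (A : set X) :
    cubedSpace R :=
  @CubedSpace R (sub_space A)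
    (fun d => [set c | @cubes R X d (fun s => val (c s))]).

Definition tame (R : realType) (X : cubedSpace R) (Y : diffSpace R)
    (f : X -> Y) : Prop :=
  smooth f /\
  forall d (c : cube_space R d -> X), cubes c ->
    tame_on_subcomplex (f \o c : cube_space R d -> Y).

Lemma unit_interval0 (R : realType) : (0 : R) \in @unit_interval R.
Proof. by rewrite inE /unit_interval /= lexx ler01. Qed.

Lemma unit_interval1 (R : realType) : (1 : R) \in @unit_interval R.
Proof. by rewrite inE /unit_interval /= lexx ler01. Qed.

Definition I0 (R : realType) : I_space R := SigSub (unit_interval0 R).
Definition I1 (R : realType) : I_space R := SigSub (unit_interval1 R).

Lemma cube_front (R : realType) (d : nat) (s : cube_space R (d + 1)) :
  lsubmx (val s : 'rV[R]_(d + 1)) \in @cube R d.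
Proof.
have /set_mem sP := valP s.
by rewrite inE => i; rewrite mxE; exact: sP.
Qed.

Lemma cube_last (R : realType) (d : nat) (s : cube_space R (d + 1)) :
  rsubmx (val s : 'rV[R]_(d + 1)) 0 0 \in @unit_interval R.
Proof.
have /set_mem sP := valP s.
by rewrite inE /unit_interval /= mxE; exact: sP.
Qed.

(* The identification of I^(d+1) with I^d x I. *)
Definition cube_split (R : realType) (d : nat) (s : cube_space R (d + 1)) :
    prod_space (cube_space R d) (I_space R) :=
  (SigSub (cube_front s), SigSub (cube_last s)).

Definition tame_homotopy (R : realType) (X : cubedSpace R) (Y : diffSpace R)
    (h : prod_space X (I_space R) -> Y) : Prop :=
  [/\ smooth h,
      tame (fun x => h (x, I0 R)),
      tame (fun x => h (x, I1 R)) &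
      forall d (c : cube_space R d -> X), cubes c ->
        tame_on_subcomplex
          ((fun s => h (c (cube_split s).1, (cube_split s).2)) :
             cube_space R (d + 1) -> Y)].

(* Main.v *)
Require Import Defs.
From mathcomp Require Import all_boot all_order all_algebra.
From mathcomp Require Import all_classical all_reals all_analysis.
From mathcomp Require Import ring lra.
From Stdlib Require Import Eqdep_dec.

(** The extension is given by a single explicit formula on each component, with
    no induction over the cubes.

    Let the component be a cubical subcomplex [K] of I^n and let [L] be the part
    of [K] lying in [A].  Up to reparametrization [K] has finitely many faces, so
    [f] and [h] are tame with a common constant [e]: they do not change when a
    coordinate at distance at most [e] from an endpoint 0 or 1 is moved to that
    endpoint.  Let [r] be the map that moves every coordinate at distance at most
    [d = e / 2] from an endpoint to that endpoint.  It is discontinuous, but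
    tameness gives [f \o r = f] on [K] and [h (r x) t = h x t] on [L].  Choose a
    smooth bump function [rho], equal to 1 near [L] and nonzero only at points
    [x] with [r x] in [L], and insensitive to moving coordinates near the
    endpoints.  Then

      H x t = h (r x) (rho x * t) if r x lies in [L], and H x t = f x otherwise

    restricts to [h] on [L] and to [f] at time 0.  To make it tame near t = 1,
    the time [t] is first replaced by [slow t], which is constant near 1 and
    equal to [t] except where [h] is constant in time.

    Smoothness of [H] ([extension_smooth]) is a local matter.  Near a point where
    [rho] vanishes on a neighbourhood, [H] is [f].  Near any other point [x0], [r]
    takes values in [L] and the coordinates it moves are among those moved at
    [x0]; moving all of these is an affine map, which by tameness of [h] may
    replace [r] in the formula.  Thus [H] is locally the composite of [h] with a
    smooth map.

    The bump functions are built from exp (- 1 / x), whose smoothness is proved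
    by differentiating the family x ^- k * exp (- 1 / x) ([is_derive_flat]).  The
    disjoint union of the extensions over the components is the required
    homotopy ([part_extension], [glue_tame]). *)

Set Implicit Arguments.
Unset Strict Implicit.
Unset Printing Implicit Defensive.

Import Order.TTheory GRing.Theory Num.Theory.
Import numFieldNormedType.Exports.

Local Open Scope classical_set_scope.
Local Open Scope ring_scope.

(** * A smooth step function *)

Section Flat.
Context {R : realType}.

(** [flat k x] is [x ^- k * exp (- 1 / x)], extended by 0 to the nonpositive
    reals.  The family is closed under differentiation up to linear
    combinations, which makes all its members smooth. *)
Definition flat (k : nat) (x : R) : R :=
  if 0 < x then x^-1 ^+ k * expR (- x^-1) else 0.

Lemma flat_le0 k x : x <= 0 -> flat k x = 0.
Proof. by rewrite /flat ltNge => ->. Qed.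

Lemma flat_gt0 k x : 0 < x -> 0 < flat k x.
Proof.
by move=> x0; rewrite /flat x0 mulr_gt0 ?expR_gt0 // exprn_gt0 ?invr_gt0.
Qed.

Lemma flat_ge0 k x : 0 <= flat k x.
Proof.
by have [/(flat_gt0 k)/ltW//|x0] := ltP 0 x; rewrite flat_le0.
Qed.

(** A quadratic bound at the origin, from [(y / m) ^ m <= exp y] with [m = k + 2]
    and [y = 1 / x]; it makes the derivative of [flat k] vanish there. *)
Lemma flat_le k x : 0 < x -> flat k x <= (k.+2)%:R ^+ k.+2 * x ^+ 2.
Proof.
move=> x0; rewrite /flat x0 expRN.
set m : R := k.+2%:R; have m0 : 0 < m by rewrite ltr0n.
have y0 : 0 < x^-1 by rewrite invr_gt0.
have my0 : 0 < m^-1 * x^-1 by rewrite mulr_gt0 ?invr_gt0.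
have le : (m^-1 * x^-1) ^+ k.+2 <= expR x^-1.
  have E : x^-1 = m * (m^-1 * x^-1) by rewrite mulrA divff ?mul1r // lt0r_neq0.
  rewrite [in expR _]E expRM_natl.
  rewrite lerXn2r ?nnegrE ?expR_ge0 ?(ltW my0) //.
  by apply: le_trans (expR_ge1Dx _); rewrite lerDr ler01.
have h : (expR x^-1)^-1 <= (m * x) ^+ k.+2.
  rewrite -[leRHS]invrK lef_pV2 ?posrE ?expR_gt0 ?invr_gt0 ?exprn_gt0 ?mulr_gt0 //.
  by rewrite -exprVn invfM.
apply: le_trans (ler_wpM2l _ h) _; first by rewrite exprn_ge0 // ltW.
rewrite exprMn mulrCA ler_wpM2l ?exprn_ge0 ?(ltW m0) //.
by rewrite -[in x ^+ k.+2]addn2 exprD mulrA -exprMn mulVf ?lt0r_neq0 // expr1n mul1r.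
Qed.

Lemma is_derive_flat k (x : R) :
  is_derive x 1 (flat k) (flat k.+2 x - k%:R * flat k.+1 x).
Proof.
have [x0|x0|x0] := ltgtP 0 x.
- have ix : is_derive x 1 (fun y : R => y^-1) (- (x ^- 2)).
    have := @is_deriveV R id x 1 1 _ (is_derive_id _ _).
    rewrite (gt_eqF x0) => /(_ isT); rewrite /= scaleNr => H.
    by apply: is_derive_eq; rewrite /GRing.scale /= mulr1.
  have H : is_derive x 1 (fun y : R => y^-1 ^+ k * expR (- y^-1))
      (flat k.+2 x - k%:R * flat k.+1 x).
    have H1 := is_deriveX k ix.
    have H2 : is_derive x 1 (fun y : R => expR (- y^-1)) (x ^- 2 * expR (- x^-1)).
      have := @is_derive1_comp _ expR (fun y => - y^-1) x _ _
        (is_derive_expR _) (is_deriveN ix).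
      by rewrite /comp opprK => H; apply: is_derive_eq; rewrite /GRing.scale /= mulrC.
    have -> : (fun y : R => y^-1 ^+ k * expR (- y^-1)) =
        (fun y : R => y^-1) ^+ k * (fun y => expR (- y^-1)).
      by apply/funext => y; rewrite fctE exprfctE.
    have H := is_deriveM H1 H2; apply: is_derive_eq; rewrite exprfctE.
    rewrite /flat x0 /GRing.scale /= -!exprVn.
    case: k {H H1} => [|k] /=; rewrite ?mulr0n ?mul0r ?mulr0 ?expr0.
      by rewrite addr0 mul1r subr0.
    set y := x^-1; set z := expR _.
    rewrite !exprS -mulr_natl; ring.
  apply: near_eq_is_derive H; near=> y.
  by rewrite /flat ifT //; near: y; exact: lt_nbhsr.
- rewrite !flat_le0 ?ltW // mulr0 subr0.
  apply: near_eq_is_derive (is_derive_cst 0 x 1); near=> y.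
  by rewrite flat_le0 // ltW //; near: y; exact: lt_nbhsl.
- rewrite -x0 !flat_le0 // mulr0 subr0.
  have flat0 :
      h^-1 *: (flat k (h *: 1 + 0) - flat k 0) @[h --> (0 : R)^'] --> (0 : R).
    set C : R := k.+2%:R ^+ k.+2.
    have C0 : 0 <= C by rewrite exprn_ge0 ?ler0n.
    have lim0 : C * `|h| @[h --> (0 : R)^'] --> (0 : R).
      rewrite -[X in _ --> X](mulr0 C); apply: cvgMl_tmp.
      rewrite -[X in _ --> X](normr0 R); apply: cvg_norm; exact: cvg_within.
    apply: (@squeeze_cvgr _ _ _ _ (fun h : R => - (C * `|h|)) (fun h => C * `|h|)).
    - near=> h.
      have h0 : h != 0 by near: h; exact: nbhs_dnbhs_neq.
      rewrite addr0 [h *: 1]mulr1 (flat_le0 _ (lexx 0)) subr0 -ler_norml.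
      rewrite normrM normfV ler_pdivrMl ?normr_gt0 // ger0_norm ?flat_ge0 //.
      have [/(flat_le0 k)->|hp] := leP h 0.
        exact: mulr_ge0 (normr_ge0 h) (mulr_ge0 C0 (normr_ge0 h)).
      by apply: le_trans (flat_le k hp) _; rewrite gtr0_norm // expr2 mulrCA.
    - by rewrite -[X in _ --> X]oppr0; exact: cvgN lim0.
    - exact: lim0.
  apply: DeriveDef.
    exact: (cvgP _ flat0).
  exact: cvg_lim flat0.
Unshelve. all: end_near.
Qed.

Lemma differentiable_flat k (x : R) : differentiable (flat k) x.
Proof. by apply/derivable1_diffP; have [] := is_derive_flat k x. Qed.

Lemma derive_flat_comp (m : nat) k (p : 'rV[R]_m -> R) x v :
  differentiable p x ->
  'D_v (flat k \o p) x =
  (flat k.+2 (p x) - k%:R * flat k.+1 (p x)) * 'D_v p x.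
Proof.
move=> dp; have df := differentiable_flat k (p x).
have dc : differentiable (flat k \o p) x by exact: differentiable_comp.
rewrite (deriveE v dc) (diff_comp dp df) /= (deriveE v dp) (diff1E df) derive1E.
by have [_ ->] := is_derive_flat k (p x); rewrite /GRing.scale /= mulrC.
Qed.

Context {m : nat} (U : set 'rV[R]_m) (oU : open U).
Implicit Types p q : 'rV[R]_m -> R.

Lemma ntimes_diff_flat N k p :
  ntimes_diff N U p -> ntimes_diff N U (fun x => flat k (p x)).
Proof.
elim: N k => //= N IH k hp; have [dp Dp] := hp; split=> [x Ux|i].
  exact: (@differentiable_comp _ _ _ _ p (flat k) x (dp _ Ux) (differentiable_flat _ _)).
have hp' := @ntimes_diffS _ _ _ _ _ hp.
apply: (@ntimes_diff_ext _ _ _ _ (fun x =>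
  (flat k.+2 (p x) + (- k%:R) * flat k.+1 (p x)) * 'D_(delta_mx 0 i) p x)) => //.
  by move=> x Ux /=; rewrite mulNr; apply/esym/derive_flat_comp/dp.
apply: ntimes_diffM => //; apply: ntimes_diffD => //; first exact: IH.
by apply: ntimes_diffM => //; [exact: ntimes_diff_cst|exact: IH].
Qed.

Lemma ntimes_diffV N p : (forall x, U x -> p x != 0) ->
  ntimes_diff N U p -> ntimes_diff N U (fun x => (p x)^-1).
Proof.
move=> p0; elim: N => //= N IH hp; have [dp Dp] := hp; split=> [x Ux|i].
  by apply: differentiableV; [exact: dp|exact: p0].
have hV := IH (@ntimes_diffS _ _ _ _ _ hp).
apply: (@ntimes_diff_ext _ _ _ _ (fun x =>
  ((-1) * ((p x)^-1 * (p x)^-1)) * 'D_(delta_mx 0 i) p x)) => //.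
  move=> x Ux; rewrite deriveV ?p0 //; last by apply: diff_derivable; exact: dp.
  by rewrite /GRing.scale /= mulN1r -invfM expr2.
apply: ntimes_diffM => //; apply: ntimes_diffM => //.
  exact: ntimes_diff_cst.
exact: ntimes_diffM.
Qed.

Lemma smooth_fun_cst (c : R) : smooth_fun U (fun=> c).
Proof. by move=> N; exact: ntimes_diff_cst. Qed.

Lemma smooth_funD p q : smooth_fun U p -> smooth_fun U q ->
  smooth_fun U (fun x => p x + q x).
Proof. by move=> sp sq N; exact: ntimes_diffD. Qed.

Lemma smooth_funM p q : smooth_fun U p -> smooth_fun U q ->
  smooth_fun U (fun x => p x * q x).
Proof. by move=> sp sq N; exact: ntimes_diffM. Qed.

Lemma smooth_funB p q : smooth_fun U p -> smooth_fun U q ->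
  smooth_fun U (fun x => p x - q x).
Proof.
move=> sp sq; have := smooth_funD sp (smooth_funM (smooth_fun_cst (-1)) sq).
by move=> H N; apply: ntimes_diff_ext (H N) => // x _; rewrite mulN1r.
Qed.

Lemma smooth_fun_prod (I : Type) (r : seq I) (P : pred I)
    (F : I -> 'rV[R]_m -> R) :
  (forall i, smooth_fun U (F i)) ->
  smooth_fun U (fun x => \prod_(i <- r | P i) F i x).
Proof.
move=> sF; elim: r => [|i r IH] N.
  apply: ntimes_diff_ext (smooth_fun_cst 1 N) => // x _.
  by rewrite big_nil.
case Pi: (P i).
  apply: ntimes_diff_ext (smooth_funM (sF i) IH N) => // x _.
  by rewrite big_cons Pi.
by apply: ntimes_diff_ext (IH N) => // x _; rewrite big_cons Pi.
Qed.

End Flat.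

Section Step.
Context {R : realType}.

(** A smooth function equal to 0 on the nonpositive reals, to 1 above 1, and
    with values in [0, 1]. *)
Definition step (s : R) : R := flat 0 s / (flat 0 s + flat 0 (1 - s)).

Lemma step_den (s : R) : 0 < flat 0 s + flat 0 (1 - s).
Proof.
have [s0|s0] := ltP 0 s; first by rewrite ltr_wpDr ?flat_gt0 ?flat_ge0.
by rewrite flat_le0 // add0r flat_gt0 // subr_gt0; lra.
Qed.

Lemma step_le0 s : s <= 0 -> step s = 0.
Proof. by move=> s0; rewrite /step flat_le0 // mul0r. Qed.

Lemma step_ge1 s : 1 <= s -> step s = 1.
Proof.
move=> s1; rewrite /step [flat 0 (1 - s)]flat_le0 ?subr_le0 // addr0 divff //.
by rewrite lt0r_neq0 // flat_gt0 //; lra.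
Qed.

Lemma step_01 s : 0 <= step s <= 1.
Proof.
rewrite /step divr_ge0 ?flat_ge0 ?(ltW (step_den s)) //=.
by rewrite ler_pdivrMr ?step_den // mul1r lerDl flat_ge0.
Qed.

Lemma smooth_fun_step m (U : set 'rV[R]_m) p : open U ->
  smooth_fun U p -> smooth_fun U (fun x => step (p x)).
Proof.
move=> oU sp.
have s1 : smooth_fun U (fun x => 1 - p x).
  by apply: smooth_funB => //; exact: smooth_fun_cst.
have sf q : smooth_fun U q -> smooth_fun U (fun x => flat 0 (q x)).
  by move=> sq N; exact: ntimes_diff_flat.
apply: smooth_funM => // [|N]; first exact: sf.
apply: ntimes_diffV => // [x _|]; first by rewrite lt0r_neq0 // step_den.
by apply: smooth_funD => //; exact: sf.
Qed.

End Step.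

(** * Faces of the cube and rounding of coordinates *)

Section Faces.
Context {R : realType} {n : nat}.
Implicit Types (x : 'rV[R]_n) (K L : set 'rV[R]_n).
Implicit Types v : {ffun 'I_n -> option bool}.

(** The distance from a point of [0, 1] to the endpoint [a]. *)
Definition edist (a : bool) (s : R) : R := if a then 1 - s else s.

Lemma edistE (a : bool) s : 0 <= s <= 1 -> `|s - a%:R| = edist a s.
Proof.
move=> /andP[s0 s1]; case: a => /=; last by rewrite subr0 ger0_norm.
by rewrite distrC ger0_norm // subr_ge0.
Qed.

Lemma edist_endpoint (a b : bool) : edist a (b%:R) = (a != b)%:R.
Proof. by case: a b => -[] /=; rewrite ?subrr ?subr0. Qed.

Lemma edistC a b s : a != b -> edist a s = 1 - edist b s.
Proof. by case: a b => -[] //= _; ring. Qed.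

(** Faces of the cube are described by sign vectors: a coordinate is either
    fixed at the endpoint [a] or free. *)
Definition sface v : set 'rV[R]_n :=
  [set x | forall i, if v i is Some a then x 0 i = a%:R else 0 <= x 0 i <= 1].

Definition union_of_faces K : Prop :=
  forall x, K x -> exists v, sface v x /\ sface v `<=` K.

Lemma sface_cube v x : sface v x -> @cube R n x.
Proof.
move=> vx i; have := vx i; case: (v i) => // a ->.
by case: a; rewrite ?lexx ?ler01.
Qed.

Lemma union_of_faces_cube K x : union_of_faces K -> K x -> @cube R n x.
Proof. by move=> cK /cK[v [/sface_cube]]. Qed.

Lemma union_of_faces_set_coord K x i a : union_of_faces K -> K x ->
  edist a (x 0 i) < 1 -> K (set_coord x i a).
Proof.
move=> cK /cK[v [vx vK]] xi; apply: vK => j.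
rewrite mxE; have [->|ij] := eqVneq j i; last exact: vx.
move: (vx i); case: (v i) => [b xb|_]; last by case: (a); rewrite ?lexx ?ler01.
by move: xi; rewrite xb edist_endpoint; case: eqVneq => [->//|_]; rewrite ltxx.
Qed.

(** Moves the coordinates selected by [w] to the prescribed endpoints. *)
Definition round (w : 'I_n -> option bool) x : 'rV[R]_n :=
  \row_i (if w i is Some a then a%:R else x 0 i).

(** The function [g] is insensitive to moving a coordinate of a point of [K] to
    an endpoint at distance at most [e]. *)
Definition tame_on (T : Type) K (e : R) (g : 'rV[R]_n -> T) : Prop :=
  forall x i a, K x -> edist a (x 0 i) <= e -> g (set_coord x i a) = g x.

(** Several coordinates may be moved at once, without leaving [K]. *)
Lemma tame_on_round (T : Type) K e (g : 'rV[R]_n -> T) w x :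
  0 <= e < 1 -> union_of_faces K -> tame_on K e g -> K x ->
  (forall i a, w i = Some a -> edist a (x 0 i) <= e) ->
  K (round w x) /\ g (round w x) = g x.
Proof.
move=> /andP[e0 e1] cK tg Kx we.
(* The coordinates are moved one after the other. *)
pose ws (s : seq 'I_n) i := if i \in s then w i else None.
suff H s : K (round (ws s) x) /\ g (round (ws s) x) = g x.
  have -> : w = ws (enum 'I_n) by apply/funext => i; rewrite /ws mem_enum.
  exact: H.
elim: s => [|j s [IH1 IH2]].
  by have -> : round (ws [::]) x = x by apply/rowP => i; rewrite mxE.
case wj : (w j) => [a|]; last first.
  suff -> : round (ws (j :: s)) x = round (ws s) x by [].
  apply/rowP => i; rewrite !mxE /ws inE.
  by have [->|//] := eqVneq i j; rewrite wj; case: ifP.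
have -> : round (ws (j :: s)) x = set_coord (round (ws s) x) j a.
  apply/rowP => i; rewrite !mxE /ws inE.
  by have [->|//] := eqVneq i j; rewrite wj.
have le : edist a (round (ws s) x 0 j) <= e.
  rewrite mxE /ws; case: ifP => _; last exact: we.
  by rewrite wj edist_endpoint eqxx.
split; last by rewrite tg.
by apply: union_of_faces_set_coord => //; exact: le_lt_trans e1.
Qed.

(** The endpoint at distance at most [d] from the coordinate [i], if any; for
    [d < 1 / 2] there is at most one. *)
Definition near_end (d : R) x (i : 'I_n) : option bool :=
  if x 0 i <= d then Some false
  else if 1 - x 0 i <= d then Some true else None.

Lemma near_endP d x i a : near_end d x i = Some a -> edist a (x 0 i) <= d.
Proof. by rewrite /near_end; case: ifP => [? [<-//]|_]; case: ifP => // ? [<-]. Qed.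

Lemma near_endE d x i a : d < 2^-1 -> edist a (x 0 i) <= d ->
  near_end d x i = Some a.
Proof.
rewrite /near_end; case: a => /= d2 xd; last by rewrite xd.
by rewrite xd ifF //; apply/negbTE; rewrite -ltNge; lra.
Qed.

Lemma near_endN d x i a : near_end d x i = None -> d < edist a (x 0 i).
Proof.
by case: a; rewrite /near_end; case: leP => // ?; case: leP.
Qed.

(** Moves to the endpoints all coordinates at distance at most [d] from them. *)
Definition retract (d : R) x : 'rV[R]_n := round (near_end d x) x.

Lemma tame_on_retract (T : Type) K e d (g : 'rV[R]_n -> T) x :
  d <= e -> 0 <= e < 1 -> union_of_faces K -> tame_on K e g -> K x ->
  K (retract d x) /\ g (retract d x) = g x.
Proof.
move=> de e01 cK tg Kx; apply: (tame_on_round e01 cK tg Kx) => i a.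
by move/near_endP => /le_trans; exact.
Qed.

Lemma retract_sface d v x : d < 2^-1 -> @cube R n x ->
  (forall i a, v i = Some a -> edist a (x 0 i) <= d) -> sface v (retract d x).
Proof.
move=> d2 cx vx i; rewrite mxE; case vi : (v i) => [a|].
  by rewrite (near_endE d2 (vx _ _ vi)).
by case: near_end => [[]|]; rewrite ?lexx ?ler01.
Qed.

Lemma retract_set_coord d x i a : 0 <= d < 2^-1 -> edist a (x 0 i) <= d ->
  retract d (set_coord x i a) = retract d x.
Proof.
move=> /andP[d0 d2] xd; apply/rowP => j; rewrite !mxE.
have [->|ij] := eqVneq j i.
  rewrite !(@near_endE d _ _ a) //.
  by rewrite mxE eqxx edist_endpoint eqxx.
by rewrite /near_end mxE (negbTE ij).
Qed.

(** * Bump functions around a union of faces *)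

(** A smooth function of [s], equal to 1 below [lo] and to 0 above [hi]. *)
Definition bump (lo hi s : R) : R := 1 - step ((s - lo) / (hi - lo)).

Lemma bump_le lo hi s : lo < hi -> s <= lo -> bump lo hi s = 1.
Proof.
move=> lh sl; rewrite /bump step_le0 ?subr0 //.
by rewrite mulr_le0_ge0 ?subr_le0 // invr_ge0 subr_ge0 ltW.
Qed.

Lemma bump_ge lo hi s : lo < hi -> hi <= s -> bump lo hi s = 0.
Proof.
move=> lh sl; rewrite /bump step_ge1 ?subrr //.
by rewrite ler_pdivlMr ?subr_gt0 // mul1r lerD2r.
Qed.

Lemma bump_01 lo hi s : 0 <= bump lo hi s <= 1.
Proof. by rewrite /bump; have := step_01 ((s - lo) / (hi - lo)); lra. Qed.

(** The bump function around a single face: the product over its fixed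
    coordinates of the bump functions of their distances to the face. *)
Definition face_bump lo hi v x : R :=
  \prod_(i < n) (if v i is Some a then bump lo hi (edist a (x 0 i)) else 1).

(** Equal to 1 within distance [lo] of the faces contained in [L], and to 0 at
    distance at least [hi] from them. *)
Definition nbhd_bump L lo hi x : R :=
  1 - \prod_(v : {ffun 'I_n -> option bool} | `[< sface v `<=` L >])
        (1 - face_bump lo hi v x).

Lemma face_bump_01 lo hi v x : 0 <= face_bump lo hi v x <= 1.
Proof.
rewrite /face_bump; apply/andP; split.
  by apply: prodr_ge0 => i _; case: (v i) => // a;
  have /andP[] := bump_01 lo hi (edist a (x 0 i)).
by apply: prodr_ile1 => i _; case: (v i) => [a|]; rewrite ?ler01 ?lexx ?bump_01.
Qed.

Lemma nbhd_bump_01 L lo hi x : 0 <= nbhd_bump L lo hi x <= 1.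
Proof.
rewrite /nbhd_bump subr_ge0 lerBlDr lerDl.
have b01 v := face_bump_01 lo hi v x.
apply/andP; split; last first.
  by apply: prodr_ge0 => v _; have := b01 v; lra.
by apply: prodr_ile1 => v _; have := b01 v; lra.
Qed.

Lemma nbhd_bump_neq0 L lo hi x : lo < hi -> nbhd_bump L lo hi x != 0 ->
  exists2 v, sface v `<=` L &
    forall i a, v i = Some a -> edist a (x 0 i) < hi.
Proof.
move=> lh; apply: contra_neqP => /forall2NP noface.
rewrite /nbhd_bump big1 ?subrr // => v /asboolP vL.
have [//|/existsNP[i /existsNP[a /not_implyP[vi /negP]]]] := noface v.
rewrite -leNgt => xi.
by rewrite /face_bump (bigD1 i) //= vi bump_ge // mul0r subr0.
Qed.

Lemma nbhd_bump_eq1 L lo hi v x : lo < hi -> sface v `<=` L ->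
  (forall i a, v i = Some a -> edist a (x 0 i) <= lo) ->
  nbhd_bump L lo hi x = 1.
Proof.
move=> lh vL xv; rewrite /nbhd_bump (bigD1 v) /=; last exact/asboolP.
rewrite [face_bump _ _ _ _]big1 ?subrr ?mul0r ?subr0 // => i _.
by case vi: (v i) => [a|//]; rewrite bump_le //; exact: xv.
Qed.

(** [nbhd_bump] is itself tame. *)
Lemma nbhd_bump_set_coord L lo hi x i a : 0 <= lo < hi -> hi <= 1 - lo ->
  edist a (x 0 i) <= lo ->
  nbhd_bump L lo hi (set_coord x i a) = nbhd_bump L lo hi x.
Proof.
move=> /andP[lo0 lh] hl xi; rewrite /nbhd_bump; congr (1 - _).
apply: eq_bigr => v _; congr (1 - _); apply: eq_bigr => j _.
case: (v j) => // b; rewrite mxE; have [->|//] := eqVneq j i.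
rewrite edist_endpoint; have [->|ba] := eqVneq b a.
  by rewrite !bump_le.
by rewrite !bump_ge //= ?(edistC _ ba); lra.
Qed.

Lemma smooth_edist m (U : set 'rV[R]_m) a q : open U ->
  smooth_fun U q -> smooth_fun U (fun u => edist a (q u)).
Proof.
by case: a => //= oU sq; apply: smooth_funB => //; exact: smooth_fun_cst.
Qed.

Lemma smooth_nbhd_bump m (U : set 'rV[R]_m) P L lo hi : open U ->
  smooth_map U P -> smooth_fun U (fun u => nbhd_bump L lo hi (P u)).
Proof.
move=> oU sP; have sc c := @smooth_fun_cst R m U oU c.
apply: smooth_funB => //; apply: smooth_fun_prod => // v.
apply: smooth_funB => //; apply: smooth_fun_prod => // i.
case: (v i) => // a; apply: smooth_funB => //.
apply: smooth_fun_step => //; apply: smooth_funM => //.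
by apply: smooth_funB => //; apply: smooth_edist => //; exact: sP.
Qed.

End Faces.

(** * Extension of a homotopy over a single cubical subcomplex *)

Section Plots.
Context {R : realType}.

Lemma smooth_map_sub m n (U V : set 'rV[R]_m) (g : 'rV[R]_m -> 'rV[R]_n) :
  V `<=` U -> smooth_map U g -> smooth_map V g.
Proof. by move=> VU sg j k; exact: ntimes_diff_sub (sg j k). Qed.

Lemma smooth_fun_sub m (U V : set 'rV[R]_m) (g : 'rV[R]_m -> R) :
  V `<=` U -> smooth_fun U g -> smooth_fun V g.
Proof. by move=> VU sg k; exact: ntimes_diff_sub (sg k). Qed.

Lemma smooth_fun_continuous m (U : set 'rV[R]_m) (g : 'rV[R]_m -> R) u :
  smooth_fun U g -> U u -> g x @[x --> u] --> g u.
Proof.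
by move=> /(_ 1%N)[dg _] Uu; apply: differentiable_continuous; exact: dg.
Qed.

(** It is enough to check that a map is a plot on small open subsets. *)
Lemma is_plot_near (Y : diffSpace R) m (U : set 'rV[R]_m) (p : 'rV[R]_m -> Y) :
  open U ->
  (forall u, U u -> exists2 W, nbhs u W &
     forall V, open V -> V `<=` U -> V `<=` W -> is_plot V p) ->
  is_plot U p.
Proof.
move=> oU loc; apply: plot_local => u Uu; have [W nW pW] := loc u Uu.
exists (U `&` interior W); split; [by split|exact: subIsetl|].
apply: pW; first exact: openI oU (@open_interior _ W).
  exact: subIsetl.
by move=> v [_ /interior_subset].
Qed.

(** A function on a subset [K] of R^n with values in [Y], represented by a total
    function, sends plots of [K] to plots of [Y]. *)
Definition smooth_on n (Y : diffSpace R) (K : set 'rV[R]_n)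
    (f : 'rV[R]_n -> Y) : Prop :=
  forall m (U : set 'rV[R]_m) (P : 'rV[R]_m -> 'rV[R]_n),
    open U -> smooth_map U P -> (forall u, U u -> K (P u)) ->
    is_plot U (fun u => f (P u)).

(** The analogue of [smooth_on] on the product of [K] with [0, 1]. *)
Definition smooth_on_prod n (Y : diffSpace R) (K : set 'rV[R]_n)
    (h : 'rV[R]_n -> R -> Y) : Prop :=
  forall m (U : set 'rV[R]_m) (P : 'rV[R]_m -> 'rV[R]_n) (Q : 'rV[R]_m -> R),
    open U -> smooth_map U P -> smooth_fun U Q ->
    (forall u, U u -> K (P u)) -> (forall u, U u -> 0 <= Q u <= 1) ->
    is_plot U (fun u => h (P u) (Q u)).

(** Uniform tameness, in space and in time, of a homotopy on [K]. *)
Definition tame_on_prod n (T : Type) (K : set 'rV[R]_n) (e : R)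
    (h : 'rV[R]_n -> R -> T) : Prop :=
  (forall t : R, 0 <= t <= 1 -> tame_on K e (h^~ t)) /\
  (forall x (t : R) a, K x -> 0 <= t <= 1 -> edist a t <= e -> h x t = h x a%:R).

End Plots.

Section Extension.
Context {R : realType} {n : nat} (Y : diffSpace R) (K L : set 'rV[R]_n).
Context (f : 'rV[R]_n -> Y) (h : 'rV[R]_n -> R -> Y) (e : R).
Hypotheses (e_gt0 : 0 < e) (e_half : e <= 2^-1).
Hypotheses (facesK : union_of_faces K) (facesL : union_of_faces L).
Hypotheses (smooth_f : smooth_on K f) (smooth_h : smooth_on_prod L h).
Hypotheses (tame_f : tame_on K e f) (tame_h : tame_on_prod L e h).
Hypothesis h0 : forall x, L x -> h x 0 = f x.

(* [d] is the rounding distance.  The bump function [rho] below falls from 1 to 0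
   between the distances [lo] and [mid], both smaller than [d]. *)
Let d := e / 2.
Let lo := e / 4.
Let mid := e * 3 / 8.

(** A smooth reparametrization of time, constant near 1, along which [h] does
    not change. *)
Definition slow (t : R) : R := t + (1 - t) * step ((t - (1 - e)) / (e / 2)).

Lemma slow_01 (t : R) : 0 <= t <= 1 -> t <= slow t <= 1.
Proof.
rewrite /slow; have := step_01 ((t - (1 - e)) / (e / 2)).
set s := step _ => /andP[s0 s1] /andP[t0 t1].
have : 0 <= (1 - t) * s by rewrite mulr_ge0 // subr_ge0.
have : (1 - t) * s <= 1 - t by rewrite ler_piMr // subr_ge0.
lra.
Qed.

Lemma slow_le (t : R) : t <= 1 - e -> slow t = t.
Proof.
move=> te; rewrite /slow step_le0 ?mulr0 ?addr0 //.
by rewrite mulr_le0_ge0 ?subr_le0 // invr_ge0 divr_ge0 // ltW.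
Qed.

Lemma slow_ge (t : R) : 1 - e / 2 <= t -> slow t = 1.
Proof.
(* [lra] reads the local hypotheses only. *)
move: (e_gt0) (e_half) => egt0 ehalf.
move=> te; rewrite /slow step_ge1; first by ring.
by rewrite ler_pdivlMr ?divr_gt0 // mul1r; lra.
Qed.

Lemma slow_tame x (t : R) : L x -> 0 <= t <= 1 -> h x (slow t) = h x t.
Proof.
move: (e_gt0) (e_half) => egt0 ehalf.
move=> Lx t01; have [/slow_le->//|te] := leP t (1 - e).
have [_ th] := tame_h; have s01 := slow_01 t01.
by rewrite (th x t true) ?(th x (slow t) true) //=; lra.
Qed.

Lemma smooth_slow m (U : set 'rV[R]_m) Q : open U -> smooth_fun U Q ->
  smooth_fun U (fun u => slow (Q u)).
Proof.
move=> oU sQ; have sc c := @smooth_fun_cst R m U oU c.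
apply: smooth_funD => //; apply: smooth_funM => //; first exact: smooth_funB.
by apply: smooth_fun_step => //; apply: smooth_funM => //; apply: smooth_funB.
Qed.

Let rho := nbhd_bump L lo mid.

(** Near [L] the extension runs [h] along the rounding map, at a speed that
    decreases to 0 away from [L]; elsewhere it is constant in time. *)
Definition extension (x : 'rV[R]_n) (t : R) : Y :=
  if `[< L (retract d x) >] then h (retract d x) (rho x * slow t) else f x.

Let e01 : 0 <= e < 1.
Proof. by move: e_gt0 e_half => ? ?; lra. Qed.

Let lomid : lo < mid.
Proof. by move: e_gt0 e_half => ? ?; rewrite /lo /mid; lra. Qed.

Let midd : mid < d.
Proof. by move: e_gt0 e_half => ? ?; rewrite /d /mid; lra. Qed.

Let de : d <= e.
Proof. by move: e_gt0 e_half => ? ?; rewrite /d; lra. Qed.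

Let d_half : d < 2^-1.
Proof. by move: e_gt0 e_half => ? ?; rewrite /d; lra. Qed.

Let d_gt0 : 0 < d.
Proof. by move: e_gt0 e_half => ? ?; rewrite /d; lra. Qed.

Let lo_gt0 : 0 < lo.
Proof. by move: e_gt0 e_half => ? ?; rewrite /lo; lra. Qed.


Lemma speed_01 x (t : R) : 0 <= t <= 1 -> 0 <= rho x * slow t <= 1.
Proof.
move=> t01; have s01 := slow_01 t01.
have /andP[r0 r1] := nbhd_bump_01 L lo mid x.
rewrite mulr_ge0 //=; last by lra.
by rewrite mulr_ile1 //; lra.
Qed.

Lemma h_retract0 x : K x -> L (retract d x) -> h (retract d x) 0 = f x.
Proof.
by move=> Kx /h0->; have [] := tame_on_retract de e01 facesK tame_f Kx.
Qed.

Lemma extension0 x : K x -> extension x 0 = f x.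
Proof.
move: (e_gt0) (e_half) => egt0 ehalf.
rewrite /extension slow_le ?mulr0 => [Kx|]; last by lra.
by case: asboolP => // Lx; exact: h_retract0.
Qed.

Lemma extension_restrict x (t : R) : L x -> 0 <= t <= 1 -> extension x t = h x t.
Proof.
move=> Lx t01; have [v [vx vL]] := facesL Lx.
have -> : extension x t = h (retract d x) (slow t).
  rewrite /extension asboolT; last first.
    by have [] := tame_on_retract de e01 facesL (tame_h.1 _ t01) Lx.
  rewrite /rho (nbhd_bump_eq1 lomid vL) ?mul1r // => i a vi.
  by have := vx i; rewrite vi => ->; rewrite edist_endpoint eqxx ltW.
have st01 : 0 <= slow t <= 1 by have := slow_01 t01; lra.
have [_ ->] := tame_on_retract de e01 facesL (tame_h.1 _ st01) Lx.
exact: slow_tame.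
Qed.

Lemma extension_tame : tame_on_prod K lo extension.
Proof.
move: (e_gt0) (e_half) => egt0 ehalf.
have lod : lo <= d by apply/ltW/(lt_trans lomid).
split=> [t t01 x i a Kx xi|x t a Kx t01 ta]; rewrite /extension.
  rewrite retract_set_coord ?(ltW d_gt0) //=; last exact: le_trans lod.
  rewrite tame_f //; last by apply: le_trans xi _; exact: le_trans de.
  by rewrite /rho nbhd_bump_set_coord // ?(ltW lo_gt0) //= /mid /lo; lra.
case: asboolP => // Lx; case: a ta => /= ta.
  by rewrite !slow_ge //; move: ta; rewrite /lo; lra.
have [_ th] := tame_h; move: ta; rewrite /lo => ta.
rewrite (@slow_le t) ?(@slow_le 0) ?mulr0 //=; [|by lra|by lra].
apply: (th _ _ false) => //=.
  have := speed_01 x t01; rewrite slow_le //; lra.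
have /andP[r0 r1] := nbhd_bump_01 L lo mid x.
apply: (@le_trans _ _ t); last by lra.
by rewrite ler_piMl //; case/andP: t01.
Qed.

Lemma extension_smooth : smooth_on_prod K extension.
Proof.
move: (e_gt0) (e_half) => egt0 ehalf.
move=> m U P Q oU sP sQ KP Q01; apply: is_plot_near => // u0 Uu0.
have cP i : P u 0 i @[u --> u0] --> P u0 0 i.
  exact: smooth_fun_continuous (sP i) Uu0.
(* The bump function [rho2] is positive only where rounding leads into [L], and
   [rho] vanishes wherever [rho2 < 1]; one of these open conditions holds. *)
pose rho2 := nbhd_bump L mid d.
have c2 : rho2 (P u) @[u --> u0] --> rho2 (P u0).
  exact: smooth_fun_continuous (smooth_nbhd_bump _ _ _ oU sP) Uu0.
have [lt1|ge1] := ltP (rho2 (P u0)) 1.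
  exists [set u | rho2 (P u) < 1]; first exact: cvgr_lt _ c2 _ lt1.
  move=> V oV VU V1.
  apply: (@plot_ext _ _ _ _ _ (fun u => f (P u))) => [u Vu|]; last first.
    by apply: smooth_f => //; [exact: smooth_map_sub sP|move=> u /VU/KP].
  have KPu := KP _ (VU _ Vu).
  rewrite /extension; case: asboolP => // Lx.
  have -> : rho (P u) = 0.
    apply/eqP/negP => /negP/(nbhd_bump_neq0 lomid)[v vL vx].
    have := V1 u Vu; rewrite /= /rho2 (nbhd_bump_eq1 midd vL) ?ltxx // => i a vi.
    by rewrite ltW // vx.
  by rewrite mul0r h_retract0.
have gt0 : 0 < rho2 (P u0) by exact: lt_le_trans ge1.
(* Near [P u0], the rounding map may be followed by the affine map [round w]
   without changing the value of [h]. *)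
pose w := near_end d (P u0).
pose near_w i u : Prop :=
  if w i is Some a then edist a (P u 0 i) < e else d < P u 0 i < 1 - d.
pose W := [set u | 0 < rho2 (P u) /\ forall i, near_w i u].
have nW : nbhs u0 W.
  apply: filterI; first exact: cvgr_gt _ c2 _ gt0.
  apply: (@filter_forall _ _ near_w (nbhs u0) _) => i; rewrite /near_w.
  case wi : (w i) => [a|].
    have ca : edist a (P u 0 i) @[u --> u0] --> edist a (P u0 0 i).
      exact: smooth_fun_continuous (smooth_edist a oU (sP i)) Uu0.
    apply: (cvgr_lt _ ca).
    by apply: le_lt_trans (near_endP wi) _; rewrite /d; lra.
  have d0 := near_endN false wi; have d1 := near_endN true wi.
  have lt1 : P u0 0 i < 1 - d by move: d1 => /=; lra.
  apply: filterS (filterI (cvgr_gt _ (cP i) _ d0) (cvgr_lt _ (cP i) _ lt1)).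
  by move=> u [/= -> ->].
exists W => // V oV VU VW.
have main u : V u -> forall t, 0 <= t <= 1 ->
    [/\ L (retract d (P u)), L (round w (P u)) &
      h (retract d (P u)) t = h (round w (P u)) t].
  move=> Vu t t01; have [pos nw] := VW _ Vu; have Ku := KP _ (VU _ Vu).
  have LP : L (retract d (P u)).
    have [v vL vx] := nbhd_bump_neq0 midd (lt0r_neq0 pos).
    apply: vL; apply: retract_sface => // [|i a vi].
      exact: union_of_faces_cube Ku.
    by rewrite ltW // vx.
  have wE i a : near_end d (P u) i = Some a -> w i = Some a.
    move=> ui; have ue := near_endP ui.
    have := nw i; rewrite /near_w; case: (w i) => [b|xi].
      case: (eqVneq b a) => [->//|/edistC-> xi].
      by exfalso; move: ue xi; rewrite /d; lra.
    by exfalso; move: ue xi; case: a {ui} => /=; lra.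
  have rr : round w (retract d (P u)) = round w (P u).
    apply/rowP => i; rewrite !mxE.
    case wi : (w i) => [//|]; case ui : near_end => [a|//].
    by rewrite (wE _ _ ui) in wi.
  have := tame_on_round (w := w) e01 facesL (tame_h.1 _ t01) LP.
  case=> [i a wi|]; last by rewrite rr => ? ->.
  rewrite mxE; case ui : near_end => [b|].
    move: wi; rewrite (wE _ _ ui) => -[->].
    by rewrite edist_endpoint eqxx ltW.
  by have := nw i; rewrite /near_w wi => /ltW.
have Q01V u : V u -> 0 <= rho (P u) * slow (Q u) <= 1.
  by move=> /VU/Q01; exact: speed_01.
apply: (@plot_ext _ _ _ _ _
    (fun u => h (round w (P u)) (rho (P u) * slow (Q u)))) => [u Vu|].
  have [LP _ <-] := main u Vu _ (Q01V _ Vu).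
  by rewrite /extension asboolT.
have sPV := smooth_map_sub VU sP; have sQV := smooth_fun_sub VU sQ.
apply: (smooth_h (P := fun u => round w (P u))) => //.
- move=> i k; case wi : (w i) => [a|].
    apply: ntimes_diff_ext (ntimes_diff_cst k a%:R oV) => // u _.
    by rewrite mxE wi.
  by apply: ntimes_diff_ext (sPV i k) => // u _; rewrite mxE wi.
- by apply: smooth_funM => //; [exact: smooth_nbhd_bump|exact: smooth_slow].
- by move=> u Vu; have [] := main u Vu _ (Q01V _ Vu).
Qed.

End Extension.

(** * Parametrized faces *)

Section ParametrizedFaces.
Context {R : realType} {n : nat}.
Implicit Types (x : 'rV[R]_n) (K : set 'rV[R]_n).

(** The sign vector of a parametrized face. *)
Definition face_sign d (F : face n d) : {ffun 'I_n -> option bool} :=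
  [ffun i => match face_coord F i with inl _ => None | inr a => Some a end].

Lemma face_mapE d (F : face n d) (s : 'rV[R]_d) i :
  face_map F s 0 i =
  match face_coord F i with inl k => s 0 k | inr a => a%:R end.
Proof. by rewrite mxE. Qed.

Lemma face_setE d (F : face n d) : @face_set R n d F = sface (face_sign F).
Proof.
apply/seteqP; split=> [_ [s cs <-] i|x xF].
  by rewrite face_mapE ffunE; case: face_coord => // k; exact: cs.
pose c k := projT1 (cid (face_coordP F k)).
have cP k : face_coord F (c k) = inl k.
  by rewrite /c; case: cid => i [].
have cU k i : face_coord F i = inl k -> c k = i.
  by rewrite /c; case: cid => j [_] /=; exact.
exists (\row_k x 0 (c k)) => [k|].
  by have := xF (c k); rewrite ffunE cP mxE.
apply/rowP => i; have := xF i; rewrite face_mapE ffunE.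
by case e : (face_coord F i) => [k|a] // _; rewrite mxE (cU _ _ e).
Qed.

Lemma face_map_set_coord d (F : face n d) (s : 'rV[R]_d) i k a :
  face_coord F i = inl k ->
  face_map F (set_coord s k a) = set_coord (face_map F s) i a.
Proof.
move=> Fi; apply/rowP => j; rewrite [RHS]mxE !face_mapE.
have [->|ji] := eqVneq j i; first by rewrite Fi mxE eqxx.
case Fj : (face_coord F j) => [k'|//]; rewrite mxE ifN //.
apply: contra_neq ji => k'k; have [i' [_ U]] := face_coordP F k.
by rewrite -(U i) // -(U j) // Fj k'k.
Qed.

(** Tameness on a parametrized face is read off its parametrization: a coordinate
    fixed on the face is already at any endpoint at distance less than 1. *)
Lemma tame_on_face (T : Type) d (F : face n d) e (g : 'rV[R]_n -> T) :
  e < 1 ->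
  (forall (s : 'rV[R]_d) k a, cube s -> edist a (s 0 k) <= e ->
     g (face_map F (set_coord s k a)) = g (face_map F s)) ->
  tame_on (face_set F) e g.
Proof.
move=> e1 tg _ i a [s cs <-]; rewrite face_mapE.
case Fi : (face_coord F i) => [k|b] le.
  by rewrite -(face_map_set_coord _ _ Fi) tg.
congr (g _); apply/rowP => j; rewrite mxE; have [->|//] := eqVneq j i.
rewrite face_mapE Fi; move: le; rewrite edist_endpoint.
by case: eqVneq => [->//|_] /le_lt_trans/(_ e1); rewrite ltxx.
Qed.

(** The points of [K] lie on parametrized faces contained in [K]. *)
Definition face_covered K : Prop :=
  forall x, K x -> exists d (F : face n d), face_set F x /\ face_set F `<=` K.

Lemma face_covered_union K : face_covered K -> union_of_faces K.
Proof.
move=> cK x /cK[d [F]]; rewrite face_setE => ?; by exists (face_sign F).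
Qed.

(** A subset of R^n has finitely many faces up to reparametrization, so a
    property that holds on each of them for small [e] holds for a common [e]. *)
Lemma face_uniform K (P : set 'rV[R]_n -> R -> Prop) :
  (forall B e e', e' <= e -> P B e -> P B e') ->
  (forall d (F : face n d), face_set F `<=` K ->
     exists2 e : R, 0 < e <= 2^-1 & P (face_set F) e) ->
  exists2 e : R, 0 < e <= 2^-1 &
    forall d (F : face n d), face_set F `<=` K -> P (face_set F) e.
Proof.
move=> mono loc.
have ev v : exists e : R, 0 < e <= 2^-1 /\
    forall d (F : face n d), face_sign F = v -> face_set F `<=` K ->
      P (face_set F) e.
  have [[d [F [Fv FK]]]|none] := pselect (exists d (F : face n d),
      face_sign F = v /\ face_set F `<=` K).
    have [e e0 Pe] := loc d F FK; exists e; split=> // d' F' F'v _.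
    by rewrite face_setE F'v -Fv -face_setE.
  exists 2^-1; rewrite invr_gt0 ltr0n lexx; split=> // d F Fv FK.
  by case: none; exists d, F.
have [e eP] := choice ev.
exists (\big[Num.min/2^-1]_v e v) => [|d F FK].
  rewrite bigmin_le_id andbT lt_bigmin ?invr_gt0 ?ltr0n // => v _.
  by have [/andP[]] := eP v.
apply: (mono _ (e (face_sign F))); last exact: (eP _).2.
exact: bigmin_le_cond.
Qed.

Lemma tame_on_le (T : Type) K e e' (g : 'rV[R]_n -> T) : e' <= e ->
  tame_on K e g -> tame_on K e' g.
Proof. by move=> le tg x i a Kx xi; apply: tg => //; exact: le_trans le. Qed.

Lemma tame_on_prod_le (T : Type) K e e' (h : 'rV[R]_n -> R -> T) : e' <= e ->
  tame_on_prod K e h -> tame_on_prod K e' h.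
Proof.
move=> le [th ch]; split=> [t t01|x t a Kx t01 ta].
  exact: tame_on_le (th t t01).
by apply: ch => //; exact: le_trans le.
Qed.

Lemma face_uniform_tame (T : Type) K (g : 'rV[R]_n -> T) : face_covered K ->
  (forall d (F : face n d), face_set F `<=` K ->
     exists2 e : R, 0 < e <= 2^-1 & tame_on (face_set F) e g) ->
  exists2 e : R, 0 < e <= 2^-1 & tame_on K e g.
Proof.
move=> cK loc.
have [B e e'|e e0 Fe] := face_uniform (P := fun B e => tame_on B e g) _ loc.
  exact: tame_on_le.
exists e => // x i a /cK[d [F [xF FK]]]; exact: (Fe d F FK).
Qed.

Lemma face_uniform_tame_prod (T : Type) K (h : 'rV[R]_n -> R -> T) :
  face_covered K ->
  (forall d (F : face n d), face_set F `<=` K ->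
     exists2 e : R, 0 < e <= 2^-1 & tame_on_prod (face_set F) e h) ->
  exists2 e : R, 0 < e <= 2^-1 & tame_on_prod K e h.
Proof.
move=> cK loc.
have [B e e'|e e0 Fe] := face_uniform (P := fun B e => tame_on_prod B e h) _ loc.
  exact: tame_on_prod_le.
exists e => //; split=> [t t01 x i a|x t a] /cK[d [F [xF FK]]].
  by apply: (Fe d F FK).1.
by apply: (Fe d F FK).2.
Qed.

End ParametrizedFaces.

(** * Plots of subspaces and coordinates of cubes *)

Section Lifting.
Context {R : realType}.

Lemma is_plot_set0 (Z : diffSpace R) m (U : set 'rV[R]_m) (p : 'rV[R]_m -> Z) :
  ~ (U !=set0) -> is_plot U p.
Proof. by move=> U0; apply: plot_local => u Uu; case: U0; exists u. Qed.

(** A plot with values in [B] lifts to a plot of the subspace [B]; outside the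
    domain the lift takes an arbitrary value. *)
Lemma is_plot_lift (Z : diffSpace R) (B : set Z) m (U : set 'rV[R]_m)
    (p : 'rV[R]_m -> Z) :
  U !=set0 -> is_plot U p -> (forall u, U u -> B (p u)) ->
  exists2 q : 'rV[R]_m -> sub_space B,
    is_plot U q & forall u, U u -> val (q u) = p u.
Proof.
move=> [u0 Uu0] Up Bp.
pose q u : sub_space B := match pselect (B (p u)) with
  | left b => SigSub (mem_set b)
  | right _ => SigSub (mem_set (Bp u0 Uu0)) end.
have qE u : U u -> val (q u) = p u.
  by move=> Uu; rewrite /q; case: pselect => // /(_ (Bp u Uu)).
exists q => //; apply: (@plot_ext _ _ _ _ _ p) => // u Uu.
by rewrite qE.
Qed.

(** Used to represent maps on a part of a complex by total functions of the
    position, with the default value [y0] elsewhere. *)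
Lemma factor_through (S T Y : Type) (y0 : Y) (phi : S -> T) (F : S -> Y) :
  (forall s s', phi s = phi s' -> F s = F s') ->
  exists G : T -> Y, forall s, G (phi s) = F s.
Proof.
move=> Fphi; exists (fun t => match pselect (exists s, phi s = t) with
  | left e => F (projT1 (cid e)) | right _ => y0 end) => s.
case: pselect => [e|]; last by case; exists s.
by apply: Fphi; case: cid.
Qed.

Lemma lsubmx_set_coord d (s : 'rV[R]_(d + 1)) k a :
  lsubmx (set_coord s (lshift 1 k) a) = set_coord (lsubmx s) k a.
Proof.
by apply/rowP => i; rewrite !mxE (inj_eq (@lshift_inj _ _)).
Qed.

Lemma rsubmx_set_coord_lshift d (s : 'rV[R]_(d + 1)) k a :
  rsubmx (set_coord s (lshift 1 k) a) = rsubmx s.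
Proof. by apply/rowP => i; rewrite !mxE eq_rlshift. Qed.

Lemma lsubmx_set_coord_rshift d (s : 'rV[R]_(d + 1)) k a :
  lsubmx (set_coord s (rshift d k) a) = lsubmx s.
Proof. by apply/rowP => i; rewrite !mxE eq_lrshift. Qed.

Lemma rsubmx_set_coord d (s : 'rV[R]_(d + 1)) (k : 'I_1) a :
  rsubmx (set_coord s (rshift d k) a) 0 0 = a%:R.
Proof. by rewrite !mxE !ord1 eqxx. Qed.

Lemma cube_set_coord d (s : 'rV[R]_d) k a : cube s -> cube (set_coord s k a).
Proof.
move=> cs i; rewrite mxE; case: ifP => _; last exact: cs.
by case: a; rewrite ?lexx ?ler01.
Qed.

(** The point of the cube with front coordinates [s] and last coordinate [t]. *)
Definition cube_pair d (s : 'rV[R]_d) (t : R) : 'rV[R]_(d + 1) :=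
  row_mx s t%:M.

Lemma cube_pair_cube d (s : 'rV[R]_d) t : cube s -> 0 <= t <= 1 ->
  cube (cube_pair s t).
Proof.
move=> cs t01 i; rewrite mxE; case: splitP => k _; first exact: cs.
by rewrite mxE ord1 eqxx mulr1n.
Qed.

Lemma cube_pair_lsub d (s : 'rV[R]_d) t : lsubmx (cube_pair s t) = s.
Proof. exact: row_mxKl. Qed.

Lemma cube_pair_rsub d (s : 'rV[R]_d) t : rsubmx (cube_pair s t) 0 0 = t.
Proof. by rewrite row_mxKr mxE eqxx mulr1n. Qed.

Lemma cube_pair_set_coord d (s : 'rV[R]_d) t k a :
  cube_pair (set_coord s k a) t = set_coord (cube_pair s t) (lshift 1 k) a.
Proof.
by rewrite -[RHS]hsubmxK lsubmx_set_coord rsubmx_set_coord_lshift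
  cube_pair_lsub row_mxKr.
Qed.

Lemma cube_pair_set_last d (s : 'rV[R]_d) t (a : bool) :
  cube_pair s a%:R = set_coord (cube_pair s t) (rshift d 0) a.
Proof.
rewrite -[RHS]hsubmxK lsubmx_set_coord_rshift cube_pair_lsub; congr row_mx.
by apply/rowP => i; rewrite ord1 rsubmx_set_coord mxE eqxx mulr1n.
Qed.

End Lifting.

(** * Components of a cubical complex *)

Section Component.
Context {R : realType} (X : cubicalComplex R) (j : cc_index X).
Notation n := (cc_dim j).
Notation K := (@cc_model R X j).

(** The inclusion of the component of index [j]. *)
Definition in_part (x : cc_part j) : X := existT _ j x.

(** The position in R^n of a point of the component. *)
Definition position (x : cc_part j) : 'rV[R]_n := val (cc_chart x).

Lemma in_part_inj : injective in_part.
Proof.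
move=> x x'; apply: (@inj_pair2_eq_dec _ (fun a b => pselect (a = b))
  (fun i => diff_carrier (cc_part i))).
Qed.

Lemma position_inj : injective position.
Proof.
move=> x x' /val_inj; have [g [gK _ _ _]] := cc_chartP j.
exact: (can_inj gK).
Qed.

Lemma position_model x : K (position x).
Proof. exact: set_mem (valP (cc_chart x)). Qed.

Lemma position_surj y : K y -> exists x, position x = y.
Proof.
move=> Ky; have [g [_ gK _ _]] := cc_chartP j.
by exists (g (SigSub (mem_set Ky))); rewrite /position gK.
Qed.

Lemma is_plot_in_part m (U : set 'rV[R]_m) (q : 'rV[R]_m -> cc_part j) :
  is_plot U q -> is_plot U (fun u => in_part (q u)).
Proof.
by move=> Uq; split=> [|u Uu]; [exact: plot_open Uq|exists U, j, q; split].
Qed.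

(** Smooth families of positions are positions of plots of the component. *)
Lemma is_plot_position m (U : set 'rV[R]_m) (P : 'rV[R]_m -> 'rV[R]_n) :
  open U -> smooth_map U P -> (forall u, U u -> K (P u)) -> U !=set0 ->
  exists2 q : 'rV[R]_m -> cc_part j,
    is_plot U q & forall u, U u -> position (q u) = P u.
Proof.
move=> oU sP KP U0.
have pP : @is_plot R (euclid R n) m U P by split.
have [q qU qP] := is_plot_lift U0 pP KP.
have [g [_ gK _ sg]] := cc_chartP j.
exists (g \o q) => [|u Uu]; first exact: sg.
by rewrite /position /= gK qP.
Qed.

Lemma smooth_position m (U : set 'rV[R]_m) (q : 'rV[R]_m -> cc_part j) :
  is_plot U q -> smooth_map U (fun u => position (q u)).
Proof. by have [g [_ _ sc _]] := cc_chartP j => /sc[_]. Qed.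

(** A parametrized face of the model gives a cube of the complex. *)
Lemma face_cube d (F : face n d) : face_set F `<=` K ->
  exists2 x : cube_space R d -> cc_part j,
    forall s, position (x s) = face_map F (val s) &
    @cubes R X d (fun s => in_part (x s)).
Proof.
move=> FK.
have [x xP] := choice (fun s : cube_space R d =>
  position_surj (FK _ (imageP (face_map F) (set_mem (valP s))))).
by exists x => //; exists j, F => s; exists (x s); split=> //; exact: xP.
Qed.

Lemma model_covered : face_covered K.
Proof.
have [S KE] := cc_modelP j; rewrite KE => x [d [F [SF xF]]].
by exists d, F; split=> // y yF; exists d, F.
Qed.

Context (Y : diffSpace R).

Section Map.
Context (y0 : Y) (f : X -> Y).
Hypothesis tame_f : tame f.

(** A tame map, read in the coordinates of a component, is smooth and tame with
    a uniform constant. *)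
Lemma part_map : exists g : 'rV[R]_n -> Y,
  [/\ forall x, g (position x) = f (in_part x), smooth_on K g &
      exists2 e : R, 0 < e <= 2^-1 & tame_on K e g].
Proof.
have [g gE] := @factor_through _ _ _ y0 position (f \o in_part)
  (fun s s' e => congr1 (f \o in_part) (position_inj e)).
exists g; split=> // [m U P oU sP KP|].
  have [U0|/is_plot_set0] := pselect (U !=set0); last exact.
  have [q qU qP] := is_plot_position oU sP KP U0.
  apply: (@plot_ext _ _ _ _ _ (fun u => f (in_part (q u)))) => [u Uu|].
    by rewrite -(qP u Uu) gE.
  exact: (tame_f.1 _ _ _ (is_plot_in_part qU)).
apply: (face_uniform_tame model_covered) => d F FK.
have [x xP cx] := face_cube FK.
have [e [e0 [_ et]]] := tame_f.2 _ _ cx.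
exists e => //; apply: tame_on_face => [|s k a cs le]; first by lra.
pose t : cube_space R d := SigSub (mem_set cs).
pose t' : cube_space R d := SigSub (mem_set (cube_set_coord k a cs)).
have gx u : g (face_map F (val u)) = f (in_part (x u)) by rewrite -xP gE.
rewrite (gx t) (gx t'); apply/esym/et => //.
by rewrite edistE //; exact: cs.
Qed.

End Map.

Context (A : set X).

(** The positions of the points of the component lying in [A]. *)
Definition sub_model : set 'rV[R]_n :=
  [set y | exists2 x, A (in_part x) & position x = y].

Lemma sub_model_position x : sub_model (position x) -> A (in_part x).
Proof. by case=> x' Ax' /position_inj <-. Qed.

Lemma sub_model_covered : is_subcomplex A -> face_covered sub_model.
Proof.
move=> [S [Scubes AE]] y [x Ax <-].
have [d [c [s [Sc cs]]]] : exists d c s, S d c /\ c s = in_part x.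
  by move: Ax; rewrite {1}AE.
have [i [F cF]] := Scubes _ _ Sc.
have [x' [cs' x'F]] := cF s.
have ij : i = j by have := congr1 (@projT1 _ _) (etrans (esym cs') cs).
subst i; have xx' : x' = x by apply: in_part_inj; rewrite /in_part -cs'.
exists d, F; split.
  by rewrite /position -xx' x'F; exists (val s) => //; exact: set_mem (valP s).
move=> _ [s' cs0 <-]; have [x0 [cx0 <-]] := cF (SigSub (mem_set cs0)).
exists x0 => //; rewrite AE; exists d, c, (SigSub (mem_set cs0)); split=> //.
Qed.

Lemma sub_face_cube d (F : face n d) : face_set F `<=` sub_model ->
  exists2 c : cube_space R d -> sub_cubed A,
    forall s, exists2 x, val (c s) = in_part x &
                         position x = face_map F (val s) &
    @cubes R (sub_cubed A) d c.
Proof.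
move=> FL.
have cx (s : cube_space R d) : exists a : sub_cubed A, exists2 x,
    val a = in_part x & position x = face_map F (val s).
  have [x Ax xs] := FL _ (imageP (face_map F) (set_mem (valP s))).
  by exists (SigSub (mem_set Ax)); exists x.
have [c cP] := choice cx.
exists c => //; exists j, F => s; have [x cs xs] := cP s.
by exists x.
Qed.

Context (h : prod_space (sub_cubed A) (I_space R) -> Y).

(** The analogue of [part_map] for the homotopy on [A]. *)
Lemma part_homotopy (y0 : Y) : is_subcomplex A -> tame_homotopy h ->
  exists g : 'rV[R]_n -> R -> Y,
  [/\ forall (a : sub_cubed A) x (t : I_space R),
        val a = in_part x -> g (position x) (val t) = h (a, t),
      smooth_on_prod sub_model g &
      exists2 e : R, 0 < e <= 2^-1 & tame_on_prod sub_model e g].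
Proof.
move=> subA [sh _ _ th].
pose T := {p : sub_cubed A * cc_part j * I_space R | val p.1.1 = in_part p.1.2}.
have [g gT] : exists g : 'rV[R]_n * R -> Y, forall p : T,
    g (position (sval p).1.2, val (sval p).2) = h ((sval p).1.1, (sval p).2).
  apply: (factor_through y0) => -[[[a x] t] /= ax] [[[a' x'] t'] /= ax'].
  case=> /position_inj xx' /val_inj ->; congr (h (_, _)).
  by apply: val_inj; exact: etrans ax (etrans (congr1 in_part xx') (esym ax')).
have gE (a : sub_cubed A) x (t : I_space R) :
    val a = in_part x -> g (position x, val t) = h (a, t).
  by move=> ax; exact: (gT (exist _ (a, x, t) ax)).
exists (fun y t => g (y, t)); split=> // [m U P Q oU sP sQ LP Q01|].
  have [U0|/is_plot_set0] := pselect (U !=set0); last exact.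
  have KP u : U u -> K (P u).
    by move=> /LP[x _ <-]; exact: position_model.
  have [q qU qP] := is_plot_position oU sP KP U0.
  have Aq u : U u -> A (in_part (q u)).
    by move=> Uu; apply: sub_model_position; rewrite qP //; exact: LP.
  have [a aU aP] := is_plot_lift U0 (is_plot_in_part qU) Aq.
  have pQ : @is_plot R (real_line R) m U Q by split.
  have [t tU tP] := is_plot_lift (B := @unit_interval R) U0 pQ Q01.
  apply: (@plot_ext _ _ _ _ _ (fun u => h (a u, t u))) => [u Uu|].
    by rewrite -(qP u Uu) -(tP u Uu) (gE (a u)) // aP.
  by apply: (sh _ _ (fun u => (a u, t u))); split.
apply: (face_uniform_tame_prod (sub_model_covered subA)) => d F FL.
have [c cP cc] := sub_face_cube FL.
have [e [e0 [_ et]]] := th _ _ cc.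
have gc (s : cube_space R d) (t : I_space R) :
    g (face_map F (val s), val t) = h (c s, t).
  by have [x cx <-] := cP s; exact: gE.
(* The values of [g] on the face, read off the cube of dimension [d + 1]. *)
have gpair (s : 'rV[R]_d) (t : R) (p : cube (cube_pair s t)) :
    let u : cube_space R (d + 1) := SigSub (mem_set p) in
    g (face_map F s, t) = h (c (cube_split u).1, (cube_split u).2).
  move=> u; apply: etrans (gc (cube_split u).1 (cube_split u).2).
  by rewrite /= cube_pair_lsub cube_pair_rsub.
exists e => //; split=> [t t01|_ t a [s cs <-] t01 ta].
  apply: tame_on_face => [|s k a cs le]; first by lra.
  have p := cube_pair_cube cs t01.
  have p' := cube_pair_cube (cube_set_coord k a cs) t01.
  rewrite (gpair _ _ p) (gpair _ _ p'); apply/esym.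
  apply: (et _ _ (lshift 1 k) a) => /=; last exact: cube_pair_set_coord.
  by rewrite row_mxEl edistE.
have a01 : 0 <= (a%:R : R) <= 1 by case: (a); rewrite ?lexx ?ler01.
have p := cube_pair_cube cs t01; have p' := cube_pair_cube cs a01.
rewrite (gpair _ _ p) (gpair _ _ p').
apply: (et _ _ (rshift d 0) a) => /=; last exact: cube_pair_set_last.
by rewrite row_mxEr mxE eqxx mulr1n edistE.
Qed.

(** The extension of the homotopy over one component, in coordinates. *)
Lemma part_extension (y0 : Y) (f : X -> Y) : is_subcomplex A -> tame f ->
  tame_homotopy h -> (forall a : sub_cubed A, h (a, I0 R) = f (val a)) ->
  exists H : 'rV[R]_n -> R -> Y,
  [/\ smooth_on_prod K H,
      exists2 e : R, 0 < e <= 2^-1 & tame_on_prod K e H,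
      forall x, H (position x) 0 = f (in_part x) &
      forall (a : sub_cubed A) x (t : I_space R),
        val a = in_part x -> H (position x) (val t) = h (a, t)].
Proof.
move=> subA tf th hf.
have [f' [f'E sf [e1 e1P tf']]] := part_map y0 tf.
have [h' [h'E sh [e2 e2P th']]] := part_homotopy y0 subA th.
pose e := Num.min e1 e2.
have ee1 : e <= e1 by rewrite ge_min lexx.
have ee2 : e <= e2 by rewrite ge_min lexx orbT.
have e_gt0 : 0 < e by rewrite lt_min; case/andP: e1P => ->; case/andP: e2P => ->.
have e_half : e <= 2^-1 by case/andP: e1P => _; exact: le_trans.
have facesK := face_covered_union model_covered.
have facesL := face_covered_union (sub_model_covered subA).
have tfe := tame_on_le ee1 tf'; have the := tame_on_prod_le ee2 th'.
have h'0 y : sub_model y -> h' y 0 = f' y.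
  case=> x Ax <-; rewrite f'E.
  by have := h'E (SigSub (mem_set Ax)) x (I0 R) erefl => /= ->; rewrite hf.
exists (extension sub_model f' h' e); split.
- exact: extension_smooth.
- exists (e / 4); last exact: extension_tame.
  by rewrite divr_gt0 //=; lra.
- move=> x; rewrite (extension0 e_gt0 e_half facesK tfe h'0) ?f'E //.
  exact: position_model.
- move=> a x t ax.
  have Lx : sub_model (position x).
    by exists x => //; rewrite -ax; exact: set_mem (valP a).
  rewrite extension_restrict //; first exact: h'E.
  exact: set_mem (valP t).
Qed.

End Component.

(** * Assembling the components *)

Section Assemble.
Context {R : realType} (X : cubicalComplex R) (Y : diffSpace R).
Context (G : forall j : cc_index X, 'rV[R]_(cc_dim j) -> R -> Y).
Arguments G : clear implicits.
Hypothesis smooth_G : forall j, smooth_on_prod (@cc_model R X j) (G j).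
Hypothesis tame_G : forall j,
  exists2 e : R, 0 < e <= 2^-1 & tame_on_prod (@cc_model R X j) e (G j).

(** The homotopy on the disjoint union given on each component by [G]. *)
Definition glue (p : prod_space X (I_space R)) : Y :=
  G (projT1 p.1) (position (projT2 p.1)) (val p.2).

Lemma glue_smooth : smooth glue.
Proof.
move=> m U p [[oU loc] [_ st]]; apply: plot_local => u Uu.
have [V [j [q [Vu VU qV pq]]]] := loc u Uu.
exists V; split=> //.
apply: (@plot_ext _ _ _ _ _ (fun v => G j (position (q v)) (val (p v).2))).
  by move=> v Vv; rewrite /= /glue pq.
apply: smooth_G => //.
- exact: plot_open qV.
- exact: smooth_position.
- exact: smooth_fun_sub VU st.
- by move=> v _; exact: position_model.
- by move=> v _; exact: set_mem (valP (p v).2).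
Qed.

(** On each cube, [glue] is the restriction of some [G j] to a face. *)
Lemma glue_cube d (c : cube_space R d -> X) : cubes c ->
  exists j (F : face (cc_dim j) d), face_set F `<=` @cc_model R X j /\
    forall s t, glue (c s, t) = G j (face_map F (val s)) (val t).
Proof.
move=> [j [F cF]]; exists j, F; split=> [_ [s cs <-]|s t].
  by have [x [_ <-]] := cF (SigSub (mem_set cs)); exact: position_model.
by have [x [cs xs]] := cF s; rewrite /glue /= cs /= /position xs.
Qed.

Lemma face_map_smooth m n d (F : face n d) (U : set 'rV[R]_m) P :
  open U -> smooth_map U P -> smooth_map U (fun u => face_map F (P u)).
Proof.
move=> oU sP i k; case Fi : (face_coord F i) => [l|a].
  by apply: ntimes_diff_ext (sP l k) => // u _; rewrite face_mapE Fi.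
apply: ntimes_diff_ext (ntimes_diff_cst k a%:R oU) => // u _.
by rewrite face_mapE Fi.
Qed.

Lemma glue_level_tame t : tame (fun x => glue (x, t)).
Proof.
split=> [m U p pU|d c /glue_cube[j [F [FK cE]]]].
  apply: (glue_smooth (p := fun u => (p u, t))); split=> //.
  by apply: plot_cst; exact: plot_open pU.
have [e e0 [th _]] := tame_G j.
exists e; split=> //; split=> [m U p [oU sp]|s s' k a].
  apply: (@plot_ext _ _ _ _ _ (fun u => G j (face_map F (val (p u))) (val t))).
    by move=> u _ /=; rewrite cE.
  apply: smooth_G => //.
  - exact: face_map_smooth.
  - exact: smooth_fun_cst.
  - by move=> u _; apply: FK; apply: imageP; exact: set_mem (valP (p u)).
  - by move=> u _; exact: set_mem (valP t).
rewrite edistE; last exact: (set_mem (valP s)).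
move=> sk s'E; rewrite /= !cE s'E.
have [i [Fi _]] := face_coordP F k.
rewrite (face_map_set_coord _ _ Fi) th //; first exact: set_mem (valP t).
  by apply: FK; apply: imageP; exact: set_mem (valP s).
by rewrite face_mapE Fi.
Qed.

Lemma glue_tame : tame_homotopy glue.
Proof.
split; [exact: glue_smooth|exact: glue_level_tame|exact: glue_level_tame|].
move=> d c /glue_cube[j [F [FK cE]]]; have [e e0 [th ch]] := tame_G j.
have front (s : cube_space R (d + 1)) : cube (lsubmx (val s : 'rV[R]_(d + 1))).
  exact: set_mem (cube_front s).
have last01 (s : cube_space R (d + 1)) :
    0 <= rsubmx (val s : 'rV[R]_(d + 1)) 0 0 <= 1.
  exact: set_mem (cube_last s).
exists e; split=> //; split=> [m U p [oU sp]|s s' k a].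
  apply: (@plot_ext _ _ _ _ _ (fun u =>
      G j (face_map F (lsubmx (val (p u)))) (rsubmx (val (p u)) 0 0))).
    by move=> u _ /=; rewrite cE.
  apply: smooth_G => //.
  - apply: face_map_smooth => // i l.
    by apply: ntimes_diff_ext (sp (lshift 1 i) l) => // u _; rewrite mxE.
  - move=> l.
    by apply: ntimes_diff_ext (sp (rshift d 0) l) => // u _; rewrite mxE.
  - by move=> u _; apply: FK; apply: imageP; exact: front.
rewrite edistE; last exact: (set_mem (valP s)).
have Fs : @cc_model R X j (face_map F (lsubmx (val s))).
  by apply: FK; apply: imageP; exact: front.
move=> sk s'E; rewrite !cE /= s'E {s'E}.
case: (split_ordP k) sk => {}k -> sk.
  have [i [Fi _]] := face_coordP F k.
  rewrite lsubmx_set_coord rsubmx_set_coord_lshift.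
  rewrite (face_map_set_coord _ _ Fi) th //.
  by rewrite face_mapE Fi mxE.
rewrite lsubmx_set_coord_rshift rsubmx_set_coord; apply: ch => //.
  exact: last01.
by move: sk; rewrite mxE (ord1 k).
Qed.

End Assemble.

(** Without a point of [X] there may be no default value in [Y]; then every
    condition on a homotopy on [X] is vacuous. *)
Lemma tame_homotopy_empty (R : realType) (X : cubicalComplex R)
    (Y : diffSpace R) (H : prod_space X (I_space R) -> Y) :
  ~ inhabited X -> tame_homotopy H.
Proof.
move=> X0; have noX (x : X) : False by apply: X0.
have noc d (c : cube_space R d -> X) : False.
  apply: noX; apply: c; exists 0; apply: mem_set => i.
  by rewrite mxE lexx ler01.
split=> [m U p _|||d c _]; first by case: (noX (p 0).1).
- by split=> [m U p _|d c _]; [case: (noX (p 0))|case: (noc d c)].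
- by split=> [m U p _|d c _]; [case: (noX (p 0))|case: (noc d c)].
- by case: (noc d c).
Qed.

Theorem theorem4p6 (R : realType) (X : cubicalComplex R) (A : set X)
    (Y : diffSpace R) (f : X -> Y)
    (h : prod_space (sub_cubed A) (I_space R) -> Y) :
  is_subcomplex A ->
  tame f ->
  tame_homotopy h ->
  (forall a : sub_cubed A, h (a, I0 R) = f (val a)) ->
  exists H : prod_space X (I_space R) -> Y,
    tame_homotopy H /\
    (forall x : X, H (x, I0 R) = f x) /\
    (forall (a : sub_cubed A) (t : I_space R), H (val a, t) = h (a, t)).
Proof.
move=> subA tf th hf; have [[x0]|X0] := pselect (inhabited X); last first.
  exists (fun p => f p.1); split; first exact: tame_homotopy_empty.
  by split=> // a; case: X0; split; exact: val a.
have [G GP] := all_sig (fun j =>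
  cid (@part_extension R X j Y A h (f x0) f subA tf th hf)).
exists (glue G); split.
  by apply: glue_tame => j; have [] := GP j.
split=> [x|a t].
  by case: x => j x; have [_ _ G0 _] := GP j; exact: G0.
case ax : (val a) => [j x]; have [_ _ _ Gh] := GP j.
exact: Gh.
Qed.
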